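(* Let $\sigma\colon(\mathcal M,L)\to(\mathcal B,\tilde L)$ be a pseudo-Finsler submersion such that for every $v\in\mathcal A$ the vertical space at $\pi(v)$ is $g_v$-non-degenerate. For each admissible $v$, vertical $u,w$, $g_v$-horizontal $x,y$ and arbitrary $e$ at $p$, \begin{align*} (\nabla_w\mathbf A)^v_ue&=-\mathbf A^v_{\mathbf T^v_wu}e, & (\nabla_x\mathbf A)^v_we&=-\mathbf A^v_{\mathbf A^v_xw}e,\\ (\nabla_w\mathbf T)^v_ye&=-\mathbf T^v_{\mathbf T^v_wy}e, & (\nabla_x\mathbf T)^v_ye&=-\mathbf T^v_{\mathbf A^v_xy}e. \end{align*} More succinctly, for every $h$ at $p$, $$(\nabla_h\mathbf A)^v_we=-\mathbf A^v_{(\mathbf T+\mathbf A)^v_hw}e,\qquad(\nabla_h\mathbf T)^v_xe=-\mathbf T^v_{(\mathbf T+\mathbf A)^v_hx}e.$$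
   Context: **Metrics.** A pseudo-Finsler metric on $\mathcal M$ (with projection $\pi\colon T\mathcal M\to\mathcal M$) is a smooth $L\colon\mathcal A\to\mathbb R$, $\mathcal A\subset T\mathcal M\setminus\mathbf 0$ open and invariant under positive scalar multiplication, with $L(\lambda v)=\lambda^2L(v)$ for $\lambda>0$ and with non-degenerate fundamental tensor $g_v(e,h)=\frac12\frac{\partial^2}{\partial s\partial t}L(v+se+th)|_{s=t=0}$. Elements of $\mathcal A$ are admissible. **Anisotropic calculus.** An anisotropic tensor $T$ assigns smoothly to $v\in\mathcal A$ a tensor $T_v$ (or $T^v$) on $T_{\pi(v)}\mathcal M$; an anisotropic vector field $\mathcal X$ assigns $\mathcal X_v\in T_{\pi(v)}\mathcal M$. $T_V$ is the ordinary tensor $(T_V)_q=T_{V_q}$ for an admissible local vector field $V$. Fiber derivative: $(\dot\partial T)_v(e)=\frac{d}{dt}T_{v+te}|_{t=0}$. An anisotropic connection assigns to vector fields $E,H$ an anisotropic vector field $\nabla_EH$, $v\mapsto\nabla^v_EH$, $C^\infty$-linear in $E$, additive and Leibniz in $H$. For anisotropic vector fields $\nabla^v_e\mathcal X=\nabla^v_e(\mathcal X_V)-(\dot\partial\mathcal X)_v(\nabla^v_eV)$, and for functions $f$ on $\mathcal A$, $(\nabla_ef)(v)=e(f(V))-(\dot\partial f)_v(\nabla^v_eV)$, for any admissible local extension $V$ of $v$ (independent of the choice); covariant derivatives of other anisotropic tensors are defined by the product rule. The Levi-Civita–Chern connection $\nabla$ of $(\mathcal M,L)$ is the unique anisotropic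 connection with $\nabla^v_EH-\nabla^v_HE=[E,H]_{\pi(v)}$ and $\nabla g=0$. **Submersions.** Let $\sigma\colon\mathcal M\to\mathcal B$ be a surjective map with surjective differential, $\mathcal V_p=\ker d\sigma_p$ (vertical vectors). An admissible $v\in T_p\mathcal M$ is horizontal if $g_v(v,w)=0$ for all $w\in\mathcal V_p$; a vector is $g_v$-horizontal if it is $g_v$-orthogonal to $\mathcal V_p$. $\sigma\colon(\mathcal M,L)\to(\mathcal B,\tilde L)$ is a pseudo-Finsler submersion if the restriction of $L$ to the tangent spaces of the fibers is a pseudo-Finsler metric on each fiber, and $L(v)=\tilde L(d\sigma(v))$ for every horizontal $v$. **O'Neill tensors.** For admissible $v\in T_p\mathcal M$, write $e=e^\top_v+e^\bot_v$ with $e^\top_v\in\mathcal V_p$ and $e^\bot_v$ $g_v$-horizontal; $E^\top,E^\bot$ are the anisotropic vector fields $v\mapsto(E_v)^\top_v$, $v\mapsto(E_v)^\bot_v$. Put $\chi^v_he=(\nabla^v_hE^\bot)^\top_v+(\nabla^v_hE^\top)^\bot_v$ for any extension $E$ of $e$ (tensorial), and $\mathbf T^v_be=\chi^v_{b^\top_v}e$, $\mathbf A^v_be=\chi^v_{b^\bot_v}e$. *)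

(* Defs.v *)
(* Smooth manifolds and anisotropic calculus are built here on the Frechet
   derivatives of MathComp-Analysis in the normed modules 'rV[R]_n. *)
From HB Require Import structures.
From mathcomp Require Import all_boot all_order all_algebra.
From mathcomp Require Import all_classical all_reals all_analysis.
Set Implicit Arguments.
Unset Strict Implicit.
Unset Printing Implicit Defensive.
Import Order.TTheory GRing.Theory Num.Theory numFieldNormedType.Exports.
Local Open Scope classical_set_scope.
Local Open Scope ring_scope.

Section Smooth.
Context {R : realType} {V W : normedModType R}.

(* Only used for finite-dimensional V, where it is the usual notion: all
   directional derivatives up to order k exist and are continuous on U. *)
Fixpoint Ck (k : nat) (U : set V) (f : V -> W) : Prop :=
  match k with
  | 0 => forall x, U x -> {for x, continuous f}
  | k'.+1 => (forall x, U x -> differentiable f x) /\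
             (forall v, Ck k' U ('D_v f))
  end.

Definition smooth (U : set V) (f : V -> W) : Prop := forall k, Ck k U f.

End Smooth.

Record chart (R : realType) (n : nat) (M : topologicalType) := Chart {
  cdom : set M ;
  cmap : M -> 'rV[R]_n ;
  cinv : 'rV[R]_n -> M ;
  cdom_open : open cdom ;
  cimg_open : open (cmap @` cdom) ;
  cmapK : forall p, cdom p -> cinv (cmap p) = p ;
  cmap_cont : forall p, cdom p -> {for p, continuous cmap} ;
  cinv_cont : forall x, (cmap @` cdom) x -> {for x, continuous cinv} }.

(* The atlas comes with a chart [chart_at p] chosen around each point p. A
   tangent vector at p is the row vector of its components in [chart_at p], so
   T_p M is 'rV[R]_n for every p, and TM is represented by pairs of a point and
   a row vector. No regularity of p |-> chart_at p is assumed: every notion of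
   smoothness below is tested in the charts of the atlas, through the
   isomorphisms [tcoord] and [tvec]. *)
Record manifold (R : realType) (n : nat) := Manifold {
  mpoint :> topologicalType ;
  mhausdorff : hausdorff_space mpoint ;
  msecond_countable : @second_countable mpoint ;
  mindex : Type ;
  mchart : mindex -> chart R n mpoint ;
  mcompat : forall i j, smooth
    (cmap (mchart i) @` (cdom (mchart i) `&` cdom (mchart j)))
    (cmap (mchart j) \o cinv (mchart i)) ;
  mat : mpoint -> mindex ;
  mat_dom : forall p, cdom (mchart (mat p)) p }.

Definition chart_at (R : realType) (n : nat) (M : manifold R n) (p : M) :
  chart R n M := mchart (mat p).

Section TangentBundle.
Context {R : realType} {n : nat} {M : manifold R n}.
Implicit Types (p q : M) (i : mindex M) (U : set M).

(* Components in the chart i of the tangent vector v at p, and conversely the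
   tangent vector at p with components y in the chart i. *)
Definition tcoord i p (v : 'rV[R]_n) : 'rV[R]_n :=
  'd (cmap (mchart i) \o cinv (chart_at p)) (cmap (chart_at p) p) v.
Definition tvec i p (y : 'rV[R]_n) : 'rV[R]_n :=
  'd (cmap (chart_at p) \o cinv (mchart i)) (cmap (mchart i) p) y.

Definition chart_img i U : set 'rV[R]_n :=
  cmap (mchart i) @` (U `&` cdom (mchart i)).

Definition smooth_fun U (f : M -> R) : Prop :=
  forall i, smooth (chart_img i U) (f \o cinv (mchart i)).

Definition smooth_field U (E : M -> 'rV[R]_n) : Prop :=
  forall i, smooth (chart_img i U)
    (fun x => let p := cinv (mchart i) x in tcoord i p (E p)).

(* Subsets of TM are families D of subsets of the tangent spaces. *)
Definition tchart_img i (D : M -> set 'rV[R]_n) : set ('rV[R]_n * 'rV[R]_n) :=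
  [set z | chart_img i setT z.1 /\
           D (cinv (mchart i) z.1) (tvec i (cinv (mchart i) z.1) z.2)].

Definition open_tm (D : M -> set 'rV[R]_n) : Prop :=
  forall i, open (tchart_img i D).

Definition smooth_afun (D : M -> set 'rV[R]_n) (f : M -> 'rV[R]_n -> R) : Prop :=
  forall i, smooth (tchart_img i D)
    (fun z => let p := cinv (mchart i) z.1 in f p (tvec i p z.2)).

Definition smooth_afield (D : M -> set 'rV[R]_n)
    (X : M -> 'rV[R]_n -> 'rV[R]_n) : Prop :=
  forall i, smooth (tchart_img i D)
    (fun z => let p := cinv (mchart i) z.1 in tcoord i p (X p (tvec i p z.2))).

(* The local vector field with constant components in [chart_at p] and value e
   at p; it is smooth on the domain of [chart_at p]. *)
Definition const_ext p (e : 'rV[R]_n) : M -> 'rV[R]_n :=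
  fun q => tvec (mat p) q e.

(* e(f), for a tangent vector e at p *)
Definition dir_der p (e : 'rV[R]_n) (f : M -> R) : R :=
  'D_e (f \o cinv (chart_at p)) (cmap (chart_at p) p).

Definition lie_bracket (E H : M -> 'rV[R]_n) (p : M) : 'rV[R]_n :=
  let loc F := fun x =>
    let q := cinv (chart_at p) x in tcoord (mat p) q (F q) in
  let x := cmap (chart_at p) p in
  'D_(E p) (loc H) x - 'D_(H p) (loc E) x.

End TangentBundle.

Section SmoothMap.
Context {R : realType} {n m : nat} {M : manifold R n} {B : manifold R m}.

Definition smooth_map (s : M -> B) : Prop :=
  continuous s /\
  forall i j, smooth (chart_img i (s @^-1` cdom (mchart j)))
    (cmap (mchart j) \o s \o cinv (mchart i)).

Definition tmap (s : M -> B) (p : M) (v : 'rV[R]_n) : 'rV[R]_m :=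
  'd (cmap (chart_at (s p)) \o s \o cinv (chart_at p)) (cmap (chart_at p) p) v.

Definition embedding (s : M -> B) : Prop :=
  [/\ smooth_map s, injective s, (forall p, injective (tmap s p)) &
      forall O : set M, open O -> exists2 O' : set B, open O' & O = s @^-1` O'].

End SmoothMap.

Section PseudoFinsler.
Context {R : realType} {n : nat} {M : manifold R n}.

Definition fund (L : M -> 'rV[R]_n -> R) (p : M) (v e h : 'rV[R]_n) : R :=
  2^-1 * 'D_e ('D_h (L p)) v.

Definition pseudo_finsler (A : M -> set 'rV[R]_n) (L : M -> 'rV[R]_n -> R) :
    Prop :=
  [/\ open_tm A,
      forall p, ~ A p 0,
      forall p v (l : R), A p v -> 0 < l ->
        A p (l *: v) /\ L p (l *: v) = l ^+ 2 * L p v,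
      smooth_afun A L
    & forall p v, A p v ->
        forall e, (forall h, fund L p v e h = 0) -> e = 0].

(* The first two arguments of [nabla] are the (possibly only locally defined)
   vector fields E and H; only their smooth germs at p matter for
   [nabla E H p v]. This is the form in which the connection is applied to
   local extensions. *)
Definition aconnection (A : M -> set 'rV[R]_n)
    (nabla : (M -> 'rV[R]_n) -> (M -> 'rV[R]_n) -> M -> 'rV[R]_n -> 'rV[R]_n) :
    Prop :=
  forall (U : set M), open U ->
  forall E E' H H' : M -> 'rV[R]_n,
    smooth_field U E -> smooth_field U E' ->
    smooth_field U H -> smooth_field U H' ->
  [/\ smooth_afield (fun p v => U p /\ A p v) (nabla E H),
      ((forall q, U q -> E q = E' q /\ H q = H' q) ->
        forall p v, U p -> A p v -> nabla E H p v = nabla E' H' p v),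
      (forall p v, U p -> A p v ->
        nabla (fun q => E q + E' q) H p v = nabla E H p v + nabla E' H p v /\
        nabla E (fun q => H q + H' q) p v = nabla E H p v + nabla E H' p v)
    & forall f : M -> R, smooth_fun U f -> forall p v, U p -> A p v ->
        nabla (fun q => f q *: E q) H p v = f p *: nabla E H p v /\
        nabla E (fun q => f q *: H q) p v =
          dir_der p (E p) f *: H p + f p *: nabla E H p v].

Section Covariant.
Variable nabla :
  (M -> 'rV[R]_n) -> (M -> 'rV[R]_n) -> M -> 'rV[R]_n -> 'rV[R]_n.

(* In this section a vector at p is extended, where the value does not depend
   on the extension, by [const_ext]. For an admissible v, [const_ext p v] is
   admissible near p because the set of admissible vectors is open. *)

(* nabla^v_e H, for a tangent vector e at p *)
Definition cov (p : M) (v e : 'rV[R]_n) (H : M -> 'rV[R]_n) : 'rV[R]_n :=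
  nabla (const_ext p e) H p v.

Definition cov_afield (p : M) (v e : 'rV[R]_n)
    (X : M -> 'rV[R]_n -> 'rV[R]_n) : 'rV[R]_n :=
  let V := const_ext p v in
  cov p v e (fun q => X q (V q)) - 'D_(cov p v e V) (X p) v.

Definition cov_afun (p : M) (v e : 'rV[R]_n) (f : M -> 'rV[R]_n -> R) : R :=
  let V := const_ext p v in
  dir_der p e (fun q => f q (V q)) - 'D_(cov p v e V) (f p) v.

(* Covariant derivatives (nabla_h G)_v(b, e) and (nabla_h S)^v_b e of
   anisotropic tensors of type (0,2) and (1,2), by the product rule. *)
Definition cov_tensor02 (G : M -> 'rV[R]_n -> 'rV[R]_n -> 'rV[R]_n -> R)
    (p : M) (v h b e : 'rV[R]_n) : R :=
  let X := const_ext p b in let Y := const_ext p e in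
  cov_afun p v h (fun q w => G q w (X q) (Y q))
  - G p v (cov p v h X) e - G p v b (cov p v h Y).

Definition cov_tensor12
    (S : M -> 'rV[R]_n -> 'rV[R]_n -> 'rV[R]_n -> 'rV[R]_n)
    (p : M) (v h b e : 'rV[R]_n) : 'rV[R]_n :=
  let X := const_ext p b in let Y := const_ext p e in
  cov_afield p v h (fun q w => S q w (X q) (Y q))
  - S p v (cov p v h X) e - S p v b (cov p v h Y).

End Covariant.

Definition levi_civita_chern (A : M -> set 'rV[R]_n) (L : M -> 'rV[R]_n -> R)
    (nabla : (M -> 'rV[R]_n) -> (M -> 'rV[R]_n) -> M -> 'rV[R]_n -> 'rV[R]_n) :
    Prop :=
  [/\ aconnection A nabla,
      forall (U : set M) (E H : M -> 'rV[R]_n), open U ->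
        smooth_field U E -> smooth_field U H ->
        forall p v, U p -> A p v ->
          nabla E H p v - nabla H E p v = lie_bracket E H p
    & forall p v, A p v -> forall h b e,
        cov_tensor02 nabla (fund L) p v h b e = 0].

End PseudoFinsler.

Section Submersion.
Context {R : realType} {n m : nat} {M : manifold R n} {B : manifold R m}.
Variable s : M -> B.

Definition vertical (p : M) (w : 'rV[R]_n) : Prop := tmap s p w = 0.

Definition ghorizontal (L : M -> 'rV[R]_n -> R) (p : M) (v x : 'rV[R]_n) :
  Prop := forall w, vertical p w -> fund L p v x w = 0.

(* Each fiber carries its structure of embedded submanifold, which is presented
   here by an arbitrary embedding i of a manifold F with image the fiber; the
   restriction of L to its tangent spaces is the pull-back of L along di. *)
Definition pf_submersion (A : M -> set 'rV[R]_n) (L : M -> 'rV[R]_n -> R)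
    (A' : B -> set 'rV[R]_m) (L' : B -> 'rV[R]_m -> R) : Prop :=
  [/\ smooth_map s,
      (forall b, exists p, s p = b),
      (forall p y, exists v, tmap s p v = y),
      (forall (b : B) (k : nat) (F : manifold R k) (i : F -> M),
         embedding i -> range i = s @^-1` [set b] ->
         pseudo_finsler (fun q y => A (i q) (tmap i q y))
                        (fun q y => L (i q) (tmap i q y)))
    & forall p v, A p v -> ghorizontal L p v v ->
        A' (s p) (tmap s p v) /\ L p v = L' (s p) (tmap s p v)].

Definition vertical_nondegenerate (A : M -> set 'rV[R]_n)
    (L : M -> 'rV[R]_n -> R) : Prop :=
  forall p v, A p v -> forall w, vertical p w ->
    (forall w', vertical p w' -> fund L p v w w' = 0) -> w = 0.

(* The decomposition e = vpart + hpart exists and is unique when the vertical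
   space is g_v-non-degenerate. *)
Definition vpart (L : M -> 'rV[R]_n -> R) (p : M) (v e : 'rV[R]_n) : 'rV[R]_n :=
  xget 0 [set u | vertical p u /\ ghorizontal L p v (e - u)].
Definition hpart (L : M -> 'rV[R]_n -> R) (p : M) (v e : 'rV[R]_n) : 'rV[R]_n :=
  e - vpart L p v e.

Section ONeill.
Variables (L : M -> 'rV[R]_n -> R)
  (nabla : (M -> 'rV[R]_n) -> (M -> 'rV[R]_n) -> M -> 'rV[R]_n -> 'rV[R]_n).

Definition oneill_chi (p : M) (v h e : 'rV[R]_n) : 'rV[R]_n :=
  let E := const_ext p e in
  vpart L p v (cov_afield nabla p v h (fun q w => hpart L q w (E q))) +
  hpart L p v (cov_afield nabla p v h (fun q w => vpart L q w (E q))).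

Definition oneill_T (p : M) (v b e : 'rV[R]_n) : 'rV[R]_n :=
  oneill_chi p v (vpart L p v b) e.
Definition oneill_A (p : M) (v b e : 'rV[R]_n) : 'rV[R]_n :=
  oneill_chi p v (hpart L p v b) e.

End ONeill.

End Submersion.

(* Main.v *)
(* Let H and V be the horizontal and vertical projections, so that
   A_b = chi_(H b) and T_b = chi_(V b), and write nabla for the covariant
   derivative along h. For a vector b extended by a field with H b = 0 at v, the field H b vanishes at v, so that
   nabla (chi_(H b) e) = chi_(nabla (H b)) e, where H (nabla (H b)) = nabla (H b)
   at v. Subtracting A_(nabla b) e, that is
   chi_(H (nabla (H b))) e + chi_(H (nabla (V b))) e, leaves
   - chi_(H (nabla (V b))) e, and H (nabla (V b)) = H (chi_h b). Exchanging H and V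
   gives the equation on T, and chi_h = T_h + A_h.

   The extensions, and the charts in which they are constant, vary with the point
   without any regularity. The covariant derivative and chi are therefore
   computed in one fixed chart, where they are visibly smooth and independent of
   the extensions. *)
Require Import Defs.
From HB Require Import structures.
From mathcomp Require Import all_boot all_order all_algebra.
From mathcomp Require Import all_classical all_reals all_analysis.
Import Order.TTheory GRing.Theory Num.Theory numFieldNormedType.Exports.
Local Open Scope classical_set_scope.
Local Open Scope ring_scope.
Set Implicit Arguments.
Unset Strict Implicit.
Unset Printing Implicit Defensive.

(** * Smooth maps *)

(** In a chart of [M] and the induced chart of the tangent bundle, an anisotropic vector field is a
    map X of z = (x, y). Subtracting its fiber derivative along nabla_b V turns the derivative of
    X(V) into the derivative of X along the horizontal lift (b, - Gamma(b, y)), in which the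
    derivative of the extension V has cancelled. The covariant derivative becomes a first-order
    operator on open sets of pairs of row vectors, subject to the Leibniz rule, and the argument
    reduces to algebra with two complementary projection matrices Q and Q' that depend on z and act
    on row vectors from the right.

    The projections are defined pointwise by choice, yet they have to be differentiated in z. The
    horizontal one is therefore written as D N^-1 D^T G^-1, with D the matrix of the differential of
    the submersion, G that of g_v, and N = D^T G^-1 D. Non-degeneracy of the vertical space makes N
    invertible; it is used at all admissible vectors near v, since a derivative needs a
    neighbourhood. Smoothness then follows from Cramer's rule. *)

Section Differentials.
Context {R : realType}.
Implicit Types U V W : normedModType R.

(** The first-order expansion only involves the germ at [x], so the expansion of [f] serves for [g],
    and uniqueness of the differential does the rest. This transports every identity of local
    expressions that holds only on an open set. *)
Lemma near_eq_diff V W (f g : V -> W) x :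
  (\near x, f x = g x) -> differentiable f x ->
  [/\ f x = g x, differentiable g x & 'd g x = 'd f x :> (V -> W)].
Proof.
move=> fg df.
have fgx : f x = g x by exact: nbhs_singleton fg.
have H : g \o shift x = cst (g x) + 'd f x +o_ 0 id.
  apply/eqaddoP => e e0.
  have := diff_locally df; move/eqaddoP => /(_ e e0).
  move=> H1.
  have H2 : \forall y \near (0 : V), f (y + x) = g (y + x).
    move: fg; rewrite (near_shift 0) /= => fg.
    by apply: filterS fg => y /=; rewrite subr0.
  near=> y.
  have -> : (g \o shift x - (cst (g x) + 'd f x)) y =
            (f \o shift x - (cst (f x) + 'd f x)) y.
    by rewrite !fctE /= fgx; congr (_ - _); apply/esym; near: y.
  by near: y.
have E : 'd g x = 'd f x :> (V -> W).
  by apply: diff_unique => //; exact: diff_continuous.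
split=> //; apply/diff_locallyP; rewrite E; split=> //.
exact: diff_continuous.
Unshelve. all: by end_near. Qed.

Lemma differentiable_scale V W (k : V -> R) (f : V -> W) x :
  differentiable k x -> differentiable f x ->
  differentiable (fun y => k y *: f y) x /\
  forall v, 'd (fun y => k y *: f y) x v = k x *: 'd f x v + 'd k x v *: f x.
Proof.
move=> dk df.
(* Scaling is packed as a bilinear map on R and W: the product rule is then the chain rule for a
   continuous bilinear map. *)
have bl : bilinear_for (GRing.Scale.Law.clone _ _ *:%R _)
    (GRing.Scale.Law.clone _ _ *:%R _) (@GRing.scale R W).
  split=> [u|u] a y z /=; first by rewrite scalerDl scalerA.
  by rewrite scalerDr !scalerA mulrC.
pose blM := bilinear_isBilinear.Build R R W W _ _ (@GRing.scale R W) bl.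
pose B : {bilinear R -> W -> W} := HB.pack (@GRing.scale R W) blM.
have cB : continuous (fun p : R * W => B p.1 p.2).
  by move=> p; apply: scale_continuous.
have -> : (fun y => k y *: f y) =
    (fun p : R * W => B p.1 p.2) \o (fun y => (k y, f y)) by [].
have dp := differentiable_pair dk df.
have dB := differentiable_bilin (k x, f x) cB.
split; first exact: differentiable_comp.
move=> v; rewrite diff_comp // diff_pair //=.
by rewrite (congr1 (fun h => h ('d k x v, 'd f x v)) (diff_bilin (k x, f x) cB)).
Qed.

Lemma diff_add_at V W (f g : V -> W) x :
  differentiable f x -> differentiable g x ->
  differentiable (fun y => f y + g y) x /\
  forall v, 'd (fun y => f y + g y) x v = 'd f x v + 'd g x v.
Proof.
move=> df dg; rewrite (_ : (fun y => f y + g y) = f + g) //.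
by split; [exact: differentiableD|move=> v; rewrite diffD].
Qed.

Lemma diff_comp_at U V W (f : U -> V) (g : V -> W) x v :
  differentiable f x -> differentiable g (f x) ->
  'd (fun y => g (f y)) x v = 'd g (f x) ('d f x v).
Proof.
by move=> df dg; rewrite (_ : (fun y => g (f y)) = g \o f) // diff_comp.
Qed.

End Differentials.

(** * Closure properties of C^k maps *)

Section CkTheory.
Context {R : realType}.
Implicit Types (U V W : normedModType R) (k : nat).

Lemma Ck_sub V W k (O O' : set V) (f : V -> W) :
  O' `<=` O -> Ck k O f -> Ck k O' f.
Proof.
elim: k f => [|k IH] f sO /=; first by move=> H x /sO/H.
by move=> [d H]; split=> [x /sO/d|v]; last exact: IH.
Qed.

Lemma Ck_ext V W k (O : set V) (f g : V -> W) : open O ->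
  (forall x, O x -> f x = g x) -> Ck k O f -> Ck k O g.
Proof.
move=> oO; elim: k f g => [|k IH] f g fg /=.
  move=> H x Ox; have fx := H x Ox.
  rewrite /prop_for /continuous_at in fx *.
  rewrite -(fg x Ox); apply: cvg_trans fx; apply: near_eq_cvg.
  by apply: filterS (open_nbhs_nbhs (conj oO Ox)) => y /fg ->.
have fgn x : O x -> \near x, f x = g x.
  by move=> Ox; apply: filterS (open_nbhs_nbhs (conj oO Ox)) => y /fg.
move=> [d H]; split=> [x Ox|v].
  by have [] := near_eq_diff (fgn x Ox) (d x Ox).
by apply: (IH ('D_v f)) => // x Ox; apply: near_eq_derive; exact: fgn.
Qed.

(** The induction step shared by the closure properties below. A formula for the derivative is known
    on [O] only, and [O] is open, so it may replace the directional derivative there. *)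
Lemma Ck_ext_derive V W k (O : set V) (f g : V -> W) (dg : V -> V -> W) :
  open O ->
  (forall x, O x -> differentiable g x /\ forall v, 'd g x v = dg v x) ->
  (forall v, Ck k O (dg v)) -> Ck k.+1 O g.
Proof.
move=> oO H1 H2; split=> [x /H1[]|v] //.
apply: Ck_ext (H2 v) => // x /H1[d e].
by rewrite deriveE.
Qed.

Lemma CkW V W k (O : set V) (f : V -> W) : Ck k.+1 O f -> Ck k O f.
Proof.
elim: k f => [|k IH] f /= [d H].
  by move=> x /d; exact: differentiable_continuous.
by split=> // v; apply: IH.
Qed.

Lemma Ck_cst V W k (O : set V) (a : W) : Ck k O (fun=> a).
Proof.
elim: k a => [|k IH] a /=; first by move=> x _; exact: cst_continuous.
split=> [x _|v]; first exact: differentiable_cst.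
rewrite (_ : 'D_v _ = fun=> 0) //; apply/funext => x.
by rewrite derive_cst.
Qed.

Lemma Ck_add V W k (O : set V) (f g : V -> W) :
  open O -> Ck k O f -> Ck k O g -> Ck k O (fun x => f x + g x).
Proof.
move=> oO; elim: k f g => [|k IH] f g /=.
  by move=> H1 H2 x Ox; apply: continuousD; [exact: H1|exact: H2].
move=> [d1 H1] [d2 H2].
apply: (@Ck_ext_derive _ _ _ _ f _ (fun v x => 'D_v f x + 'D_v g x)) => // [|v].
  move=> x Ox; have df := d1 x Ox; have dg := d2 x Ox.
  have [d e] := diff_add_at df dg; split=> // v.
  by rewrite e !deriveE.
exact: IH.
Qed.

Lemma Ck_scale V W k (O : set V) (c : V -> R) (f : V -> W) :
  open O -> Ck k O c -> Ck k O f -> Ck k O (fun x => c x *: f x).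
Proof.
move=> oO; elim: k c f => [|k IH] c f.
  move=> H1 H2 x Ox; have cx := H1 x Ox; have fx := H2 x Ox.
  by apply: continuousZ.
move=> C1 C2; have [d1 H1] := C1; have [d2 H2] := C2.
apply: (@Ck_ext_derive _ _ _ _ f _
  (fun v x => c x *: 'D_v f x + 'D_v c x *: f x)) => // [|v].
  move=> x Ox; have dc := d1 x Ox; have df := d2 x Ox.
  have [d e] := differentiable_scale dc df; split=> // v.
  by rewrite e !deriveE.
apply: Ck_add => //; apply: IH.
- exact: CkW.
- exact: H2.
- exact: H1.
- exact: CkW.
Qed.

Lemma Ck_inv V k (O : set V) (c : V -> R) :
  open O -> (forall x, O x -> c x != 0) -> Ck k O c ->
  Ck k O (fun x => (c x)^-1).
Proof.
move=> oO c0; elim: k => [|k IH] C.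
  by move=> x Ox; apply: (@continuousV R V c x); [exact: c0|exact: C].
have [d H] := C.
(* The derivative - c^-2 c' is written with [(c x)^-1] itself, so that the induction hypothesis
   applies to its factors. *)
apply: (@Ck_ext_derive _ _ _ _ c _
  (fun v x => ((-1) * ((c x)^-1 * (c x)^-1)) * 'D_v c x)) => // [|v].
  move=> x Ox; have dc := d x Ox; have cx := c0 x Ox.
  split; first exact: differentiableV.
  move=> v; rewrite (congr1 (fun h => h v) (diffV dc cx)) deriveE //=.
  by rewrite mulN1r -invfM -expr2.
apply: (@Ck_scale _ R) (H v) => //; apply: (@Ck_scale _ R) => //.
  exact: Ck_cst.
by apply: (@Ck_scale _ R) => //; apply/IH/CkW.
Qed.

Lemma Ck_sum V W k (O : set V) (I : Type) (s : seq I) (f : I -> V -> W) :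
  open O -> (forall i, Ck k O (f i)) -> Ck k O (fun x => \sum_(i <- s) f i x).
Proof.
move=> oO H; elim: s => [|i s IH].
  by rewrite (_ : (fun _ => _) = fun=> 0) ?funeqE => [|x]; rewrite ?big_nil //; exact: Ck_cst.
rewrite (_ : (fun _ => _) = fun x => f i x + \sum_(j <- s) f j x).
  exact: Ck_add.
by apply/funext => x; rewrite big_cons.
Qed.

Lemma Ck_prod V k (O : set V) (I : Type) (s : seq I) (f : I -> V -> R) :
  open O -> (forall i, Ck k O (f i)) -> Ck k O (fun x => \prod_(i <- s) f i x).
Proof.
move=> oO H; elim: s => [|i s IH].
  by rewrite (_ : (fun _ => _) = fun=> 1) ?funeqE => [|x]; rewrite ?big_nil //; exact: Ck_cst.
rewrite (_ : (fun _ => _) = fun x => f i x *: \prod_(j <- s) f j x).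
  exact: (@Ck_scale _ R).
by apply/funext => x; rewrite big_cons.
Qed.

Lemma Ck_lin V W k (O : set V) (f : {linear V -> W}) :
  continuous f -> Ck k O f.
Proof.
case: k => [|k] cf /=; first by move=> x _; exact: cf.
split=> [x _|v]; first exact: linear_differentiable.
rewrite (_ : 'D_v _ = fun=> f v); first exact: Ck_cst.
apply/funext => x; rewrite deriveE; last exact: linear_differentiable.
by rewrite (congr1 (fun h => h v) (diff_lin x cf)).
Qed.

Lemma Ck_comp_lin U V W k (O : set U) (f : U -> V) (l : {linear V -> W}) :
  open O -> continuous l -> Ck k O f -> Ck k O (fun x => l (f x)).
Proof.
move=> oO cl; elim: k f => [|k IH] f.
  by move=> H x Ox; apply: (@continuous_comp _ _ _ f l); [exact: H|exact: cl].
move=> [d H]; apply: (@Ck_ext_derive _ _ _ _ (fun x => l (f x)) _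
   (fun v x => l ('D_v f x))) => // [|v].
  move=> x Ox; have df := d x Ox; have dl := linear_differentiable (f x) cl.
  split; first exact: differentiable_comp.
  by move=> v; rewrite diff_comp_at // deriveE // (congr1 (fun h => h _) (diff_lin (f x) cl)).
by apply: IH; exact: H.
Qed.

Lemma Ck_pair U V W k (O : set U) (f : U -> V) (g : U -> W) :
  open O -> Ck k O f -> Ck k O g -> Ck k O (fun x => (f x, g x)).
Proof.
move=> oO; elim: k f g => [|k IH] f g.
  by move=> H1 H2 x Ox; apply: cvg_pair; [exact: H1|exact: H2].
move=> [d1 H1] [d2 H2]; apply: (@Ck_ext_derive _ _ _ _ (fun x => (f x, g x)) _
  (fun v x => ('D_v f x, 'D_v g x))) => // [|v].
  move=> x Ox; have df := d1 x Ox; have dg := d2 x Ox.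
  split; first exact: differentiable_pair.
  by move=> v; rewrite diff_pair // !deriveE.
by apply: IH; [exact: H1|exact: H2].
Qed.

End CkTheory.

(* A finite basis with continuous coordinate functions: this is all that the
   chain rule below needs to know about the intermediate space. *)
Definition finite_coords (R : realType) (V : normedModType R) : Prop :=
  exists (N : nat) (e : 'I_N -> V) (c : 'I_N -> {linear V -> R}),
    (forall j, continuous (c j)) /\ (forall v, v = \sum_j c j v *: e j).

Section Coordinates.
Context {R : realType}.

Definition rcoord n (j : 'I_n) (v : 'rV[R]_n) : R := v ord0 j.

Lemma rcoord_linear n (j : 'I_n) : linear (rcoord j).
Proof. by move=> a u v; rewrite /rcoord !mxE. Qed.

HB.instance Definition _ n (j : 'I_n) :=
  GRing.isLinear.Build R 'rV[R]_n R _ (rcoord j) (rcoord_linear j).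

Lemma rcoord_continuous n (j : 'I_n) : continuous (rcoord j).
Proof. exact: coord_continuous. Qed.

Lemma finite_coords_rV n : finite_coords 'rV[R]_n.
Proof.
exists n, (fun j => delta_mx ord0 j), (fun j => rcoord j : {linear _ -> _}).
split=> [j|v]; first exact: rcoord_continuous.
exact: row_sum_delta.
Qed.

Lemma finite_coords_prod (V W : normedModType R) :
  finite_coords V -> finite_coords W -> finite_coords (V * W)%type.
Proof.
move=> [N [e [c [cc ec]]]] [N' [e' [c' [cc' ec']]]].
pose E (j : 'I_(N + N')) : V * W :=
  match fintype.split j with inl i => (e i, 0) | inr i => (0, e' i) end.
pose F (j : 'I_(N + N')) (v : V * W) : R :=
  match fintype.split j with inl i => c i v.1 | inr i => c' i v.2 end.
have lin (j : 'I_(N + N')) : linear (F j).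
  by move=> a u v; rewrite /F; case: (fintype.split j) => i; rewrite linearP.
pose linM (j : 'I_(N + N')) :=
  GRing.isLinear.Build R (V * W)%type R *:%R (F j) (lin j).
pose C (j : 'I_(N + N')) : {linear (V * W)%type -> R} := HB.pack (F j) (linM j).
exists (N + N')%N, E, C; split=> [j v|v].
  rewrite /C /= /F; case: (fintype.split j) => i.
    by apply: (@continuous_comp _ _ _ fst (c i)); [exact: cvg_fst|exact: cc].
  by apply: (@continuous_comp _ _ _ snd (c' i)); [exact: cvg_snd|exact: cc'].
rewrite big_split_ord /= /E /F.
have El i : fintype.split (lshift N' i) = inl i by rewrite (unsplitK (inl i)).
have Er i : fintype.split (rshift N i) = inr i by rewrite (unsplitK (inr i)).
under eq_bigr do rewrite El.
under [X in _ + X]eq_bigr do rewrite Er.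
case: v => v w /=; rewrite [in LHS](ec v) [in LHS](ec' w).
have -> : \sum_(i < N) c i v *: (e i, 0 : W) = (\sum_(i < N) c i v *: e i, 0).
  by elim/big_rec2: _ => // i x y _ ->; congr pair; rewrite /= scaler0 addr0.
have -> : \sum_(i < N') c' i w *: (0 : V, e' i) = (0, \sum_(i < N') c' i w *: e' i).
  by elim/big_rec2: _ => // i x y _ ->; congr pair; rewrite /= scaler0 addr0.
by congr pair; rewrite /= ?addr0 ?add0r.
Qed.

End Coordinates.

Section CkComposition.
Context {R : realType}.
Implicit Types (U V W : normedModType R) (k : nat).

(** [Ck] differentiates along fixed directions, whereas the chain rule differentiates [g] along the
    moving direction ['D_v f x]. Expanding that direction in a finite basis leaves derivatives of
    [g] along fixed vectors, to which the induction hypothesis applies. *)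
Lemma Ck_comp U V W k (O : set U) (G : set V) (f : U -> V) (g : V -> W) :
  finite_coords V -> open O -> (forall x, O x -> G (f x)) ->
  Ck k O f -> Ck k G g -> Ck k O (fun x => g (f x)).
Proof.
move=> [N [e [c [cc ec]]]] oO fOG; elim: k g => [|k IH] g.
  move=> Cf Cg x Ox; apply: (@continuous_comp _ _ _ f g); first exact: Cf.
  by apply: Cg; exact: fOG.
move=> Cf [dg Hg]; have [df Hf] := Cf.
apply: (@Ck_ext_derive _ _ _ _ _ (fun x => g (f x)) _
  (fun v x => \sum_j c j ('D_v f x) *: 'D_(e j) g (f x))) => // [|v].
  move=> x Ox; have d1 := df x Ox; have d2 := dg _ (fOG x Ox).
  split; first exact: differentiable_comp.
  move=> v; rewrite diff_comp_at // [X in 'd g _ X]ec linear_sum.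
  by apply: eq_bigr => j _; rewrite linearZ /= !deriveE.
apply: Ck_sum => // j; apply: Ck_scale => //.
  by apply: Ck_comp_lin => //; exact: Hf.
by apply: (IH ('D_(e j) g)); [exact: CkW|exact: Hg].
Qed.

Lemma Ck_diff U V W k (O : set U) (G : set V) (f w : U -> V) (g : V -> W) :
  finite_coords V -> open O -> (forall x, O x -> G (f x)) ->
  Ck k O f -> Ck k O w -> Ck k.+1 G g -> Ck k O (fun x => 'd g (f x) (w x)).
Proof.
move=> fV oO fOG Cf Cw [dg Hg]; have [N [e [c [cc ec]]]] := fV.
apply: (@Ck_ext _ _ _ _ _ (fun x => \sum_j c j (w x) *: 'D_(e j) g (f x))) => //.
  move=> x Ox; have d2 := dg _ (fOG x Ox).
  rewrite [X in 'd g _ X]ec linear_sum.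
  by apply: eq_bigr => j _; rewrite linearZ /= !deriveE.
apply: Ck_sum => // j; apply: Ck_scale => //; first exact: (@Ck_comp_lin _ _ _ _ _ _ w (c j)).
exact: (@Ck_comp _ _ _ _ _ _ f ('D_(e j) g) fV oO fOG Cf (Hg _)).
Qed.

End CkComposition.

(** * Smooth maps and smooth families of matrices *)

Section SmoothTheory.
Context {R : realType}.
Implicit Types U V W : normedModType R.

Lemma smooth_sub V W (O O' : set V) (f : V -> W) :
  O' `<=` O -> smooth O f -> smooth O' f.
Proof. by move=> s H k; exact: Ck_sub (H k). Qed.

Lemma smooth_ext V W (O : set V) (f g : V -> W) : open O ->
  (forall x, O x -> f x = g x) -> smooth O f -> smooth O g.
Proof. by move=> oO fg H k; exact: Ck_ext (H k). Qed.

Lemma smooth_differentiable V W (O : set V) (f : V -> W) x :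
  smooth O f -> O x -> differentiable f x.
Proof. by move=> H Ox; have [d _] := H 1; exact: d. Qed.

Lemma smooth_derive V W (O : set V) (f : V -> W) v :
  smooth O f -> smooth O ('D_v f).
Proof. by move=> H k; have [_ E] := H k.+1; exact: E. Qed.

Lemma smooth_cst V W (O : set V) (a : W) : smooth O (fun=> a : W).
Proof. by move=> k; exact: Ck_cst. Qed.

Lemma smooth_id V (O : set V) : smooth O (fun x => x).
Proof. by move=> k; apply: (@Ck_lin _ _ _ _ _ idfun) => x; exact: cvg_id. Qed.

Lemma smooth_add V W (O : set V) (f g : V -> W) :
  open O -> smooth O f -> smooth O g -> smooth O (fun x => f x + g x).
Proof. by move=> oO H1 H2 k; exact: Ck_add. Qed.

Lemma smooth_scale V W (O : set V) (c : V -> R) (f : V -> W) :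
  open O -> smooth O c -> smooth O f -> smooth O (fun x => c x *: f x).
Proof. by move=> oO H1 H2 k; exact: Ck_scale. Qed.

Lemma smooth_mul V (O : set V) (c f : V -> R) :
  open O -> smooth O c -> smooth O f -> smooth O (fun x => c x * f x).
Proof. exact: (@smooth_scale V R). Qed.

Lemma smooth_inv V (O : set V) (c : V -> R) :
  open O -> (forall x, O x -> c x != 0) -> smooth O c ->
  smooth O (fun x => (c x)^-1).
Proof. by move=> oO c0 H k; exact: Ck_inv. Qed.

Lemma smooth_sum V W (O : set V) (I : Type) (s : seq I) (f : I -> V -> W) :
  open O -> (forall i, smooth O (f i)) ->
  smooth O (fun x => \sum_(i <- s) f i x).
Proof. by move=> oO H k; apply: Ck_sum => // i; exact: H. Qed.

Lemma smooth_prod V (O : set V) (I : Type) (s : seq I) (f : I -> V -> R) :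
  open O -> (forall i, smooth O (f i)) ->
  smooth O (fun x => \prod_(i <- s) f i x).
Proof. by move=> oO H k; apply: Ck_prod => // i; exact: H. Qed.

Lemma smooth_pair U V W (O : set U) (f : U -> V) (g : U -> W) :
  open O -> smooth O f -> smooth O g -> smooth O (fun x => (f x, g x)).
Proof. by move=> oO H1 H2 k; exact: Ck_pair. Qed.

Lemma smooth_fst V W (O : set (V * W)) : smooth O (fun z => z.1).
Proof. by move=> k; apply: (@Ck_lin _ _ _ _ _ fst) => x; exact: cvg_fst. Qed.

Lemma smooth_snd V W (O : set (V * W)) : smooth O (fun z => z.2).
Proof. by move=> k; apply: (@Ck_lin _ _ _ _ _ snd) => x; exact: cvg_snd. Qed.

Lemma smooth_comp U V W (O : set U) (G : set V) (f : U -> V) (g : V -> W) :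
  finite_coords V -> open O -> (forall x, O x -> G (f x)) ->
  smooth O f -> smooth G g -> smooth O (fun x => g (f x)).
Proof. by move=> fV oO fOG H1 H2 k; exact: (Ck_comp fV oO fOG). Qed.

Lemma smooth_diff U V W (O : set U) (G : set V) (f w : U -> V) (g : V -> W) :
  finite_coords V -> open O -> (forall x, O x -> G (f x)) ->
  smooth O f -> smooth O w -> smooth G g ->
  smooth O (fun x => 'd g (f x) (w x)).
Proof. by move=> fV oO fOG H1 H2 H3 k; exact: (Ck_diff fV oO fOG). Qed.

Lemma smooth_coord V n (O : set V) (f : V -> 'rV[R]_n) i j :
  open O -> smooth O f -> smooth O (fun x => f x i j : R).
Proof.
rewrite (ord1 i) => oO H k.
exact: (@Ck_comp_lin _ _ _ _ _ _ f (rcoord j) oO (@rcoord_continuous _ _ j)).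
Qed.

Lemma smooth_row V n (O : set V) (f : V -> 'rV[R]_n) :
  open O -> (forall j, smooth O (fun x => f x ord0 j : R)) -> smooth O f.
Proof.
move=> oO H.
apply: (@smooth_ext _ _ _ (fun x => \sum_j f x ord0 j *: delta_mx ord0 j)) => //.
  by move=> x _; rewrite -row_sum_delta.
by apply: smooth_sum => // j; apply: smooth_scale => //; exact: smooth_cst.
Qed.

(** Smoothness is asked entry by entry, since products, determinants and inverses are computed from
    the entries. *)
Definition smooth_mx V m n (O : set V) (A : V -> 'M[R]_(m, n)) :=
  forall i j, smooth O (fun x => A x i j : R).

Lemma smooth_mx_row V n (O : set V) (f : V -> 'rV[R]_n) :
  open O -> smooth O f -> smooth_mx O f.
Proof. by move=> oO H i j; exact: smooth_coord. Qed.

Lemma smooth_mx_sub V m n (O O' : set V) (A : V -> 'M[R]_(m, n)) :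
  O' `<=` O -> smooth_mx O A -> smooth_mx O' A.
Proof. by move=> s H i j; exact: smooth_sub (H i j). Qed.

Lemma smooth_mx_mul V m n p (O : set V) (A : V -> 'M[R]_(m, n))
    (B : V -> 'M[R]_(n, p)) :
  open O -> smooth_mx O A -> smooth_mx O B -> smooth_mx O (fun x => A x *m B x).
Proof.
move=> oO HA HB i j.
apply: (@smooth_ext _ _ _ (fun x => \sum_k A x i k * B x k j)) => //.
  by move=> x _; rewrite mxE.
by apply: smooth_sum => // k; exact: smooth_mul.
Qed.

Lemma smooth_mx_tr V m n (O : set V) (A : V -> 'M[R]_(m, n)) :
  open O -> smooth_mx O A -> smooth_mx O (fun x => (A x)^T).
Proof.
move=> oO HA i j; apply: smooth_ext (HA j i) => // x _.
by rewrite mxE.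
Qed.

Lemma smooth_det V n (O : set V) (A : V -> 'M[R]_n) :
  open O -> smooth_mx O A -> smooth O (fun x => \det (A x)).
Proof.
move=> oO HA; rewrite /determinant.
apply: smooth_sum => // s; apply: smooth_mul => //; first exact: smooth_cst.
by apply: smooth_prod => // i; exact: HA.
Qed.

(** Cramer's rule: on [O] the entries of the inverse are cofactors divided by a determinant that
    does not vanish. *)
Lemma smooth_mx_inv V n (O : set V) (A : V -> 'M[R]_n) :
  open O -> (forall x, O x -> A x \in unitmx) ->
  smooth_mx O A -> smooth_mx O (fun x => invmx (A x)).
Proof.
move=> oO uA HA i j.
apply: (@smooth_ext _ _ _ (fun x => (\det (A x))^-1 *
    ((-1) ^+ (j + i) * \det (row' j (col' i (A x)))))) => //.
  by move=> x Ox; rewrite /invmx uA // mxE mxE.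
apply: smooth_mul => //.
  apply: smooth_inv => //; last exact: smooth_det.
  by move=> x /uA; rewrite unitmxE unitfE.
apply: smooth_mul => //; first exact: smooth_cst.
apply: smooth_det => // a b.
by apply: smooth_ext (HA (lift j a) (lift i b)) => // x _; rewrite !mxE.
Qed.

Lemma smooth_mulmx V n p (O : set V) (f : V -> 'rV[R]_n)
    (B : V -> 'M[R]_(n, p)) :
  open O -> smooth O f -> smooth_mx O B -> smooth O (fun x => f x *m B x).
Proof.
move=> oO Hf HB; apply: smooth_row => // j.
by apply: smooth_mx_mul => //; exact: smooth_mx_row.
Qed.

Lemma smooth_row_of V m n (O : set V) (A : V -> 'M[R]_(m, n)) i :
  open O -> smooth_mx O A -> smooth O (fun x => row i (A x)).
Proof.
move=> oO HA; apply: smooth_row => // j.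
by apply: smooth_ext (HA i j) => // x _; rewrite mxE.
Qed.

Lemma diff_rcoord V n (v : V -> 'rV[R]_n) z w j : differentiable v z ->
  differentiable (fun y => v y ord0 j : R) z /\
  'd (fun y => v y ord0 j : R) z w = 'd v z w ord0 j.
Proof.
move=> dv; have cj := @rcoord_continuous R n j.
have dj := linear_differentiable (v z) cj.
split; first exact: (differentiable_comp dv dj).
rewrite (_ : (fun y => _) = fun y => rcoord j (v y)) // diff_comp_at //.
by rewrite (congr1 (fun f => f _) (diff_lin (v z) cj)).
Qed.

End SmoothTheory.

(** * Anisotropic calculus in coordinates *)

Section LocalCalculus.
Context {R : realType} {n : nat}.
Local Notation rV := 'rV[R]_n.
Variable Gam : 'I_n -> 'I_n -> rV * rV -> rV.
Implicit Types (z : rV * rV) (b c e h : rV).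

(** Here z = (x, y) collects the coordinates of a point and the components of a tangent vector
    there. The value stands for the covariant derivative along b, at z, of the field with constant
    components c. *)
Definition christoffel z b c : rV :=
  \sum_k \sum_j (b ord0 k * c ord0 j) *: Gam k j z.

Lemma christoffel_linear_l z c : linear (christoffel z ^~ c).
Proof.
move=> a u v; rewrite /christoffel scaler_sumr -big_split; apply: eq_bigr => k _.
rewrite scaler_sumr -big_split; apply: eq_bigr => j _ /=.
by rewrite !mxE mulrDl scalerDl scalerA mulrA.
Qed.

Lemma christoffel_linear_r z b : linear (christoffel z b).
Proof.
move=> a u v; rewrite /christoffel scaler_sumr -big_split; apply: eq_bigr => k _.
rewrite scaler_sumr -big_split; apply: eq_bigr => j _ /=.
by rewrite !mxE mulrDr scalerDl scalerA mulrCA.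
Qed.

HB.instance Definition _ z b := GRing.isLinear.Build R rV rV _
  (christoffel z b) (christoffel_linear_r z b).

Lemma christoffelDr z b c c' :
  christoffel z b (c + c') = christoffel z b c + christoffel z b c'.
Proof. exact: (linearD (christoffel z b)). Qed.

Lemma christoffelZr z b (a : R) c :
  christoffel z b (a *: c) = a *: christoffel z b c.
Proof. by rewrite linearZ. Qed.

(** The horizontal lift of b for the nonlinear connection that nabla induces on the tangent
    bundle. *)
Definition hlift z b : rV * rV := (b, - christoffel z b z.2).

Lemma hlift_linear z : linear (hlift z).
Proof.
move=> a u v; rewrite /hlift (christoffel_linear_l z z.2) opprD -scalerN.
by [].
Qed.

HB.instance Definition _ z := GRing.isLinear.Build R rV (rV * rV)%type _
  (hlift z) (hlift_linear z).

Fact lcov_subproof : {F : (rV * rV -> rV) -> rV * rV -> rV -> rV |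
  forall X z b, F X z b = 'd X z (hlift z b) + christoffel z b (X z)}.
Proof. by exists (fun X z b => 'd X z (hlift z b) + christoffel z b (X z)). Qed.

(* Coordinate expression of the covariant derivative of the anisotropic vector
   field with components X; sealed, because unification is prone to unfold
   differentials. *)
Definition lcov : (rV * rV -> rV) -> rV * rV -> rV -> rV := sval lcov_subproof.

Lemma lcovE X z b :
  lcov X z b = 'd X z (hlift z b) + christoffel z b (X z).
Proof. exact: (svalP lcov_subproof). Qed.

Lemma lcov_linear X z : linear (lcov X z).
Proof.
move=> a u v; rewrite !lcovE linearP linearP (christoffel_linear_l z (X z)).
by rewrite scalerDr addrACA.
Qed.

HB.instance Definition _ X z := GRing.isLinear.Build R rV rV _
  (lcov X z) (lcov_linear X z).

Lemma lcov_near_eq X Y z b : (\near z, X z = Y z) -> differentiable X z ->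
  lcov Y z b = lcov X z b.
Proof.
move=> XY dX; have [XYz _ e] := near_eq_diff XY dX.
rewrite (lcovE X) (lcovE Y) XYz.
exact: (congr1 (fun f => f (hlift z b) + christoffel z b (Y z)) e).
Qed.

Lemma lcov_cst c z b : lcov (fun=> c) z b = christoffel z b c.
Proof. by rewrite lcovE (diff_cst c z) add0r. Qed.

Lemma lcov_add X Y z b : differentiable X z -> differentiable Y z ->
  lcov (fun y => X y + Y y) z b = lcov X z b + lcov Y z b.
Proof.
move=> dX dY; have [_ e] := diff_add_at dX dY.
rewrite !lcovE christoffelDr [RHS]addrACA; congr (_ + _).
exact: e.
Qed.

Lemma lcov_scale (f : rV * rV -> R) X z b :
  differentiable f z -> differentiable X z ->
  lcov (fun y => f y *: X y) z b =
  'd f z (hlift z b) *: X z + f z *: lcov X z b.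
Proof.
move=> df dX; have [_ e] := differentiable_scale df dX.
rewrite !lcovE christoffelZr scalerDr addrA; congr (_ + _).
by rewrite [RHS]addrC; exact: e.
Qed.

Lemma lcov_comb (I : Type) (s : seq I) (f : I -> rV * rV -> R)
    (X : I -> rV * rV -> rV) z b :
  (forall i, differentiable (f i) z) -> (forall i, differentiable (X i) z) ->
  differentiable (fun y => \sum_(i <- s) f i y *: X i y) z /\
  lcov (fun y => \sum_(i <- s) f i y *: X i y) z b =
  \sum_(i <- s) ('d (f i) z (hlift z b) *: X i z + f i z *: lcov (X i) z b).
Proof.
move=> df dX; elim: s => [|i s [dIH IH]].
  rewrite (_ : (fun _ => _) = fun=> 0); last by apply/funext => y; rewrite big_nil.
  by rewrite lcov_cst linear0 big_nil; split=> //; exact: differentiable_cst.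
rewrite (_ : (fun _ => _) =
   fun y => f i y *: X i y + \sum_(j <- s) f j y *: X j y); last first.
  by apply/funext => y; rewrite big_cons.
have [d _] := differentiable_scale (df i) (dX i).
split; first by have [] := diff_add_at d dIH.
by rewrite lcov_add // IH lcov_scale // big_cons.
Qed.

Lemma lcov_mulmx (v : rV * rV -> rV) (A : rV * rV -> 'M[R]_n) z b :
  differentiable v z -> (forall j, differentiable (fun y => row j (A y)) z) ->
  lcov (fun y => v y *m A y) z b =
  'd v z (hlift z b) *m A z +
  \sum_j v z ord0 j *: lcov (fun y => row j (A y)) z b.
Proof.
move=> dv dA.
rewrite (_ : (fun y => v y *m A y) =
  fun y => \sum_j v y ord0 j *: row j (A y)); last first.
  by apply/funext => y; rewrite mulmx_sum_row.
have dvj j := (diff_rcoord (hlift z b) j dv).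
have [_ ->] := lcov_comb (index_enum 'I_n) b (fun j => (dvj j).1) dA.
rewrite big_split /=; congr (_ + _); rewrite mulmx_sum_row.
by apply: eq_bigr => j _; rewrite (dvj j).2.
Qed.

Section Smoothness.
Variable O : set (rV * rV).
Hypothesis oO : open O.
Hypothesis smooth_Gam : forall k j, smooth O (Gam k j).

Lemma finite_coords_T : finite_coords (rV * rV)%type.
Proof. by apply: finite_coords_prod; exact: finite_coords_rV. Qed.

Lemma smooth_christoffel (G : set (rV * rV)) (b c : rV * rV -> rV) :
  open G -> G `<=` O -> smooth G b -> smooth G c ->
  smooth G (fun z => christoffel z (b z) (c z)).
Proof.
move=> oG sG Sb Sc; apply: smooth_sum => // k; apply: smooth_sum => // j.
apply: smooth_scale => //; last exact: smooth_sub (smooth_Gam k j).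
by apply: smooth_mul => //; apply: smooth_coord.
Qed.

Lemma smooth_lcov (G : set (rV * rV)) X b :
  open G -> G `<=` O -> smooth G X -> smooth G (fun z => lcov X z b).
Proof.
move=> oG sG SX; under eq_fun do rewrite lcovE.
apply: smooth_add => //; last first.
  by apply: smooth_christoffel => //; exact: smooth_cst.
apply: (@smooth_diff _ _ _ _ G G (fun z => z) (fun z => hlift z b) X) => //.
- exact: finite_coords_T.
- exact: smooth_id.
apply: smooth_pair => //; first exact: smooth_cst.
rewrite (_ : (fun x => _) = fun x => (-1) *: christoffel x b x.2); last first.
  by apply/funext => x; rewrite scaleN1r.
apply: smooth_scale => //; first exact: smooth_cst.
by apply: smooth_christoffel => //; [exact: smooth_cst|exact: smooth_snd].
Qed.

End Smoothness.

End LocalCalculus.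

(** * The tensor chi of two complementary projections *)

Section LocalONeill.
Context {R : realType} {n : nat}.
Local Notation rV := 'rV[R]_n.
Variable Gam : 'I_n -> 'I_n -> rV * rV -> rV.
Implicit Types (z : rV * rV) (b c e h : rV).
Local Notation lcov := (lcov Gam).

(* Coordinate expression of chi when Q and Q' are the matrices of the horizontal
   and vertical projections. Exchanging Q and Q' does not change it, which makes
   the statements on A and T instances of one another. *)
Definition lchi (Q Q' : rV * rV -> 'M[R]_n) z b e : rV :=
  \sum_j e ord0 j *: (lcov (fun y => row j (Q y)) z b *m Q' z +
                      lcov (fun y => row j (Q' y)) z b *m Q z).

Lemma lchi_sym Q Q' z b e : lchi Q Q' z b e = lchi Q' Q z b e.
Proof. by apply: eq_bigr => j _; rewrite addrC. Qed.

Lemma lchi_linear_l Q Q' z e a b b' :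
  lchi Q Q' z (a *: b + b') e = a *: lchi Q Q' z b e + lchi Q Q' z b' e.
Proof.
rewrite /lchi scaler_sumr -big_split; apply: eq_bigr => j _ /=.
rewrite !lcov_linear !mulmxDl -!scalemxAl addrACA -(scalerDr a).
by rewrite [LHS]scalerDr !scalerA [a * _]mulrC.
Qed.

Lemma lchi0 Q Q' z e : lchi Q Q' z 0 e = 0.
Proof.
by have := lchi_linear_l Q Q' z e (-1) 0 0; rewrite scaler0 addr0 scaleN1r addNr.
Qed.

Lemma lchiD Q Q' z e b b' :
  lchi Q Q' z (b + b') e = lchi Q Q' z b e + lchi Q Q' z b' e.
Proof. by rewrite -[b in LHS]scale1r lchi_linear_l scale1r. Qed.

Lemma lchiZ Q Q' z e a b : lchi Q Q' z (a *: b) e = a *: lchi Q Q' z b e.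
Proof. by rewrite -[X in lchi _ _ _ X]addr0 lchi_linear_l lchi0 addr0. Qed.

Lemma lchi_sum Q Q' z e (I : Type) (s : seq I) (f : I -> R) (v : I -> rV) :
  lchi Q Q' z (\sum_(i <- s) f i *: v i) e =
  \sum_(i <- s) f i *: lchi Q Q' z (v i) e.
Proof.
elim: s => [|i s IH]; first by rewrite !big_nil lchi0.
by rewrite !big_cons lchiD lchiZ IH.
Qed.

Section Projectors.
Variables (O : set (rV * rV)) (Q Q' : rV * rV -> 'M[R]_n).
Hypothesis oO : open O.
Hypothesis smooth_Gam : forall k j, smooth O (Gam k j).
Hypothesis smooth_Q : smooth_mx O Q.
Hypothesis smooth_Q' : smooth_mx O Q'.
Hypothesis QDQ' : forall z, O z -> Q z + Q' z = 1%:M.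
Hypothesis QQ' : forall z, O z -> Q z *m Q' z = 0.
Hypothesis Q'Q : forall z, O z -> Q' z *m Q z = 0.

Let QQ z : O z -> Q z *m Q z = Q z.
Proof. by move=> Oz; rewrite -[RHS]mulmx1 -(QDQ' Oz) mulmxDr QQ' // addr0. Qed.

Let dQ j z : O z -> differentiable (fun y => row j (Q y)) z.
Proof. by apply: smooth_differentiable; exact: smooth_row_of. Qed.

Let dQ' j z : O z -> differentiable (fun y => row j (Q' y)) z.
Proof. by apply: smooth_differentiable; exact: smooth_row_of. Qed.

(* The derivatives of the components of v drop out because Q Q' = Q' Q = 0. *)
Lemma lchi_ext (v : rV * rV -> rV) z b : O z -> differentiable v z ->
  lcov (fun y => v y *m Q y) z b *m Q' z +
  lcov (fun y => v y *m Q' y) z b *m Q z = lchi Q Q' z b (v z).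
Proof.
move=> Oz dv; have dQz j := dQ j Oz; have dQ'z j := dQ' j Oz.
rewrite !lcov_mulmx // !mulmxDl -!mulmxA QQ' // Q'Q // !mulmx0 !add0r.
rewrite !mulmx_suml -big_split; apply: eq_bigr => j _ /=.
by rewrite -!scalemxAl -scalerDr.
Qed.

(** By linearity in b it is enough to treat constant directions, for which [smooth_lcov] applies. *)
Lemma smooth_lchi (G : set (rV * rV)) (b : rV * rV -> rV) (e : rV) :
  open G -> G `<=` O -> smooth G b -> smooth G (fun z => lchi Q Q' z (b z) e).
Proof.
move=> oG sG Sb.
have S c : smooth G (fun z => lchi Q Q' z c e).
  apply: smooth_sum => // j; apply: smooth_scale => //; first exact: smooth_cst.
  apply: smooth_add => //; apply: smooth_mulmx => //.
  - by apply: (smooth_lcov smooth_Gam) => //; apply: smooth_row_of => //; exact: smooth_mx_sub smooth_Q.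
  - exact: smooth_mx_sub smooth_Q'.
  - by apply: (smooth_lcov smooth_Gam) => //; apply: smooth_row_of => //; exact: smooth_mx_sub smooth_Q'.
  - exact: smooth_mx_sub smooth_Q.
apply: (@smooth_ext _ _ _ _
    (fun z => \sum_k b z ord0 k *: lchi Q Q' z (delta_mx ord0 k) e)) => //.
  by move=> z _; rewrite -lchi_sum -row_sum_delta.
by apply: smooth_sum => // k; apply: smooth_scale => //; apply: smooth_coord.
Qed.

(* The field b Q vanishes at z, so only its derivative contributes, and
   b Q = (b Q) Q shows that this derivative lies in the image of Q. *)
Lemma lcov_lchi_ker z h b e : O z -> b *m Q z = 0 ->
  lcov (fun y => lchi Q Q' y (b *m Q y) e) z h =
  lchi Q Q' z (lcov (fun y => b *m Q y) z h *m Q z) e.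
Proof.
move=> Oz bQ0.
have dv : differentiable (fun y => b *m Q y) z.
  apply: (smooth_differentiable _ Oz); apply: smooth_mulmx => //.
  exact: smooth_cst.
have Eext : \near z, lchi Q Q' z (b *m Q z) e =
    \sum_k (b *m Q z) ord0 k *: lchi Q Q' z (row k (Q z)) e.
  apply: filterS (open_nbhs_nbhs (conj oO Oz)) => y Oy.
  by rewrite -lchi_sum -mulmx_sum_row -mulmxA QQ.
have dvj j := (diff_rcoord (hlift Gam z h) j dv).
have dX k : differentiable (fun y => lchi Q Q' y (row k (Q y)) e) z.
  by apply: (smooth_differentiable _ Oz); apply: smooth_lchi => //; exact: smooth_row_of.
have [d E] := lcov_comb Gam (index_enum 'I_n) h (fun j => (dvj j).1) dX.
have Eext' : \near z, \sum_k (b *m Q z) ord0 k *: lchi Q Q' z (row k (Q z)) e =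
   lchi Q Q' z (b *m Q z) e.
  by apply: filterS Eext => y ->.
rewrite (lcov_near_eq Gam h Eext' d) E.
rewrite [in RHS]lcovE bQ0 (linear0 (christoffel Gam z h)) addr0.
rewrite mulmx_sum_row lchi_sum.
by apply: eq_bigr => j _; rewrite (dvj j).2 mxE scale0r addr0.
Qed.

(** The left side is the product rule for the tensor b |-> chi_(b Q), with [christoffel Gam z h b]
    the derivative of the constant extension of b. The derivative of the extension of e may be any
    [e']: its coefficient b Q vanishes. *)
Lemma lcov_oneill z h b e e' : O z -> b *m Q z = 0 ->
  lcov (fun y => lchi Q Q' y (b *m Q y) e) z h
  - lchi Q Q' z (christoffel Gam z h b *m Q z) e
  - lchi Q Q' z (b *m Q z) e' =
  - lchi Q Q' z (lchi Q Q' z h b *m Q z) e.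
Proof.
move=> Oz bQ0; rewrite lcov_lchi_ker // bQ0 lchi0 subr0.
have dv : differentiable (fun y => b *m Q y) z.
  apply: (smooth_differentiable _ Oz); apply: smooth_mulmx => //.
  exact: smooth_cst.
have dv' : differentiable (fun y => b *m Q' y) z.
  apply: (smooth_differentiable _ Oz); apply: smooth_mulmx => //.
  exact: smooth_cst.
(* The constant field b is b Q + b Q' near z, so its covariant derivative splits. The first summand
   will cancel against the derivative given by [lcov_lchi_ker]. *)
have Gb : christoffel Gam z h b =
   lcov (fun y => b *m Q y) z h + lcov (fun y => b *m Q' y) z h.
  rewrite -lcov_add // -lcov_cst.
  have E : \near z, b *m Q z + b *m Q' z = b.
    apply: filterS (open_nbhs_nbhs (conj oO Oz)) => y Oy.
    by rewrite -mulmxDr QDQ' // mulmx1.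
  have [d _] := diff_add_at dv dv'.
  exact: (lcov_near_eq Gam h E d).
have dc : differentiable (fun=> b) z by exact: differentiable_cst.
(* Of the two components of chi_h b, multiplication by Q kills the one ending in Q' and fixes the
   one ending in Q, which is the derivative of b Q' followed by Q. *)
have := lchi_ext h Oz dc; rewrite /= => <-.
rewrite Gb !mulmxDl -(mulmxA _ (Q' z) (Q z)) Q'Q // mulmx0 add0r.
rewrite -(mulmxA _ (Q z) (Q z)) QQ //.
by rewrite lchiD opprD addrA subrr add0r.
Qed.

End Projectors.
End LocalONeill.

(** * Charts *)

Section Charts.
Context {R : realType} {n : nat} {M : manifold R n}.
Implicit Types (p q : M) (i j k : mindex M) (U : set M) (x y : 'rV[R]_n).
Local Notation dom i := (cdom (mchart i)).
Local Notation phi i := (cmap (mchart i)).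
Local Notation psi i := (cinv (mchart i)).

Lemma chart_imgP i U x : chart_img i U x ->
  [/\ U (psi i x), dom i (psi i x) & phi i (psi i x) = x].
Proof. by move=> [q [Uq iq] <-]; rewrite cmapK. Qed.

Lemma chart_img_phi i U q : U q -> dom i q -> chart_img i U (phi i q).
Proof. by move=> Uq iq; exists q. Qed.

Lemma chart_img_sub i U U' : U `<=` U' -> chart_img i U `<=` chart_img i U'.
Proof. by move=> s x [q [/s Uq iq] <-]; exists q. Qed.

(** The inverse of a chart is only known to be continuous on the image of the chart, hence the
    intersection with that image. *)
Lemma open_chart_preimage i U : open U ->
  open [set x | (phi i @` dom i) x /\ U (psi i x)].
Proof.
move=> oU; rewrite openE => x [xi Uix].
have := @cinv_cont _ _ _ (mchart i) x xi.
move=> /(_ U (open_nbhs_nbhs (conj oU Uix))) /= cU.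
have cO := open_nbhs_nbhs (conj (@cimg_open _ _ _ (mchart i)) xi).
by apply: filterS2 cO cU => y yi Uy.
Qed.

Lemma open_chart_img i U : open U -> open (chart_img i U).
Proof.
move=> oU; have := @open_chart_preimage i U oU; congr open.
apply/seteqP; split=> x.
  by move=> [[q iq <-]]; rewrite cmapK // => Uq; exists q.
by move=> xi; have [Ux ix e] := chart_imgP xi; split=> //; exists (psi i x).
Qed.

Definition tr i j : 'rV[R]_n -> 'rV[R]_n := fun x => phi j (psi i x).

Lemma smooth_tr i j U : U `<=` dom j -> smooth (chart_img i U) (tr i j).
Proof.
move=> Uj; apply: smooth_sub (mcompat i j) => x [q [Uq iq] <-].
by exists q => //; split=> //; exact: Uj.
Qed.

(* Sealed like lcov. *)
Fact tchange_subproof : {F : mindex M -> mindex M -> M -> 'rV[R]_n -> 'rV[R]_n |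
  forall i j q v, F i j q v = 'd (tr i j) (phi i q) v}.
Proof. by exists (fun i j q v => 'd (tr i j) (phi i q) v). Qed.

Definition tchange := sval tchange_subproof.

Lemma tchangeE i j q v : tchange i j q v = 'd (tr i j) (phi i q) v.
Proof. exact: (svalP tchange_subproof). Qed.

Lemma tcoordE i q v : tcoord i q v = tchange (mat q) i q v.
Proof. by rewrite tchangeE. Qed.

Lemma tvecE i q v : tvec i q v = tchange i (mat q) q v.
Proof. by rewrite tchangeE. Qed.

Lemma tchange_linear i j q : linear (tchange i j q).
Proof. by move=> a u v; rewrite !tchangeE linearP. Qed.

HB.instance Definition _ i j q := GRing.isLinear.Build R 'rV[R]_n 'rV[R]_n _
  (tchange i j q) (tchange_linear i j q).

Lemma tr_differentiable i j q : dom i q -> dom j q ->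
  differentiable (tr i j) (phi i q).
Proof.
move=> iq jq; have S := @smooth_tr i j (dom j) (@subset_refl _ _).
by apply: (smooth_differentiable S); exact: chart_img_phi.
Qed.

Lemma near_chart i U q : open U -> U q -> dom i q ->
  \forall x \near phi i q, chart_img i U x.
Proof.
move=> oU Uq iq; apply: open_nbhs_nbhs; split; first exact: open_chart_img.
exact: chart_img_phi.
Qed.

Lemma tchange_id i q v : dom i q -> tchange i i q v = v.
Proof.
move=> iq; have N := near_chart (@openT _) I iq.
have E : \forall x \near phi i q, (fun y => y) x = tr i i x.
  by apply: filterS N => x /chart_imgP[_ _ e]; rewrite /tr e.
have d : differentiable (fun y : 'rV[R]_n => y) (phi i q).
  exact: (@ex_diff _ _ _ _ _ _ _ (is_diff_id (phi i q))).
have [_ _ e] := near_eq_diff E d.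
rewrite tchangeE; transitivity ('d (fun y : 'rV[R]_n => y) (phi i q) v).
  exact: (congr1 (fun f => f v) e).
exact: (congr1 (fun f => f v) (@diff_val _ _ _ _ _ _ _ (is_diff_id (phi i q)))).
Qed.

Lemma tchange_comp i j k q v : dom i q -> dom j q -> dom k q ->
  tchange j k q (tchange i j q v) = tchange i k q v.
Proof.
move=> iq jq kq.
have N := near_chart (@cdom_open _ _ _ (mchart j)) jq iq.
have E : \forall x \near phi i q, (fun y => tr j k (tr i j y)) x = tr i k x.
  by apply: filterS N => x /chart_imgP[jx ix _]; rewrite /tr cmapK.
have ijq : tr i j (phi i q) = phi j q by rewrite /tr cmapK.
have d1 := tr_differentiable iq jq.
have d2 : differentiable (tr j k) (tr i j (phi i q)).
  by rewrite ijq; exact: tr_differentiable.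
have d : differentiable (fun y => tr j k (tr i j y)) (phi i q).
  exact: (differentiable_comp d1 d2).
have [_ _ e] := near_eq_diff E d.
rewrite !tchangeE.
transitivity ('d (fun y => tr j k (tr i j y)) (phi i q) v); last first.
  by symmetry; exact: (congr1 (fun f => f v) e).
symmetry; transitivity ('d (tr j k) (tr i j (phi i q)) ('d (tr i j) (phi i q) v)).
  exact: (diff_comp_at v d1 d2).
exact: (congr1 (fun z => 'd (tr j k) z ('d (tr i j) (phi i q) v)) ijq).
Qed.

Lemma tvecK i q v : dom i q -> tcoord i q (tvec i q v) = v.
Proof.
move=> iq; rewrite tcoordE tvecE tchange_comp ?tchange_id //.
exact: mat_dom.
Qed.

Lemma tcoordK i q v : dom i q -> tvec i q (tcoord i q v) = v.
Proof.
move=> iq; rewrite tcoordE tvecE tchange_comp ?tchange_id //; exact: mat_dom.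
Qed.

Lemma tchange_tcoord i j q v : dom i q -> dom j q ->
  tchange i j q (tcoord i q v) = tcoord j q v.
Proof.
move=> iq jq; rewrite !tcoordE tchange_comp //; exact: mat_dom.
Qed.

Lemma tcoord_linear i q : linear (tcoord i q).
Proof. by move=> a u v; rewrite !tcoordE linearP. Qed.

HB.instance Definition _ i q := GRing.isLinear.Build R 'rV[R]_n 'rV[R]_n _
  (tcoord i q) (tcoord_linear i q).

Lemma tvec_linear i q : linear (tvec i q).
Proof. by move=> a u v; rewrite !tvecE linearP. Qed.

HB.instance Definition _ i q := GRing.isLinear.Build R 'rV[R]_n 'rV[R]_n _
  (tvec i q) (tvec_linear i q).

Lemma tchange_continuous i j q : dom i q -> dom j q ->
  continuous (tchange i j q).
Proof.
move=> iq jq; rewrite (_ : tchange i j q = 'd (tr i j) (phi i q)); last first.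
  by apply/funext => v; rewrite tchangeE.
by apply: diff_continuous; exact: tr_differentiable.
Qed.

Lemma tcoord_continuous i q : dom i q -> continuous (tcoord i q).
Proof.
move=> iq; rewrite (_ : tcoord i q = tchange (mat q) i q).
  by apply: tchange_continuous => //; exact: mat_dom.
by apply/funext => v; rewrite tcoordE.
Qed.

Lemma tvec_continuous i q : dom i q -> continuous (tvec i q).
Proof.
move=> iq; rewrite (_ : tvec i q = tchange i (mat q) q).
  by apply: tchange_continuous => //; exact: mat_dom.
by apply/funext => v; rewrite tvecE.
Qed.

Lemma tvec_id q v : tvec (mat q) q v = v.
Proof. by rewrite tvecE tchange_id //; exact: mat_dom. Qed.

Definition rep i (E : M -> 'rV[R]_n) : 'rV[R]_n -> 'rV[R]_n :=
  fun x => tcoord i (psi i x) (E (psi i x)).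

Lemma tr_chart_img i k U x : chart_img k U x -> U `<=` dom i ->
  chart_img i U (tr k i x).
Proof.
by move=> /chart_imgP[Ux kx e] Ui; apply: chart_img_phi => //; exact: Ui.
Qed.

(** Smoothness of a field is required in every chart, but one chart containing [U] suffices: in a
    chart k the components are the differential of the transition map applied to those in the chart
    i. *)
Lemma smooth_field_chart i U E : open U -> U `<=` dom i ->
  smooth (chart_img i U) (rep i E) -> smooth_field U E.
Proof.
move=> oU Ui SE k; have oC := @open_chart_img k U oU.
apply: (@smooth_ext _ _ _ _
   (fun x => 'd (tr i k) (tr k i x) (rep i E (tr k i x)))) => //.
  move=> x /chart_imgP[Ux kx e] /=; have ix := Ui _ Ux.
  by rewrite -(tchange_tcoord _ ix kx) tchangeE /rep /tr (cmapK ix).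
have fc := @finite_coords_rV R n.
pose G := chart_img i (dom k `&` U).
have kiG x : chart_img k U x -> G (tr k i x).
  move=> /chart_imgP[Ux kx e]; apply: chart_img_phi; first by [].
  exact: Ui.
have Skr : smooth (chart_img k U) (tr k i) by exact: smooth_tr.
apply: (@smooth_diff _ _ _ _ _ G (tr k i) (fun x => rep i E (tr k i x))) => //.
  apply: (@smooth_comp _ _ _ _ _ G (tr k i) (rep i E)) => //.
  by apply: smooth_sub SE; apply: chart_img_sub => q [].
by apply: smooth_tr => q [].
Qed.

Lemma smooth_fun_chart i U (f : M -> R) : open U -> U `<=` dom i ->
  smooth (chart_img i U) (fun x => f (psi i x)) -> smooth_fun U f.
Proof.
move=> oU Ui Sf k; have oC := @open_chart_img k U oU.
apply: (@smooth_ext _ _ _ _ (fun x => f (psi i (tr k i x)))) => //.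
  by move=> x /chart_imgP[Ux kx e] /=; rewrite /tr (cmapK (Ui _ Ux)).
apply: (@smooth_comp _ _ _ _ _ (chart_img i U) (tr k i)
   (fun x => f (psi i x))) => //.
- exact: finite_coords_rV.
- by move=> x Cx; exact: tr_chart_img.
- exact: smooth_tr.
Qed.

Lemma dir_der_chart i q e (f : M -> R) : dom i q ->
  differentiable (fun x => f (psi i x)) (phi i q) ->
  dir_der q e f = 'd (fun x => f (psi i x)) (phi i q) (tcoord i q e).
Proof.
move=> iq df; rewrite /dir_der /chart_at; set j := mat q.
have jq : dom j q by exact: mat_dom.
have N := near_chart (@cdom_open _ _ _ (mchart i)) iq jq.
have E : \forall x \near phi j q, f (psi i (tr j i x)) = (f \o psi j) x.
  by apply: filterS N => x /chart_imgP[ix jx _]; rewrite /tr (cmapK ix).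
have jiq : tr j i (phi j q) = phi i q by rewrite /tr cmapK.
have d1 := tr_differentiable jq iq.
have d2 : differentiable (fun x => f (psi i x)) (tr j i (phi j q)) by rewrite jiq.
have d := differentiable_comp d1 d2.
have [_ df' E'] := near_eq_diff E d.
rewrite tcoordE tchangeE deriveE //.
transitivity ('d (fun x => f (psi i (tr j i x))) (phi j q) e).
  exact: (congr1 (fun h => h e) E').
transitivity ('d (fun x => f (psi i x)) (tr j i (phi j q)) ('d (tr j i) (phi j q) e)).
  exact: (diff_comp_at e d1 d2).
exact: (congr1 (fun z => 'd (fun x => f (psi i x)) z ('d (tr j i) (phi j q) e)) jiq).
Qed.

(** Used to shrink the domain of a local extension V so that the coordinates of V stay in a
    prescribed open set of the tangent bundle. *)
Lemma open_section i U (w : 'rV[R]_n -> 'rV[R]_n) (G : set ('rV[R]_n * 'rV[R]_n)) :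
  open U -> U `<=` dom i -> open G ->
  (forall x, chart_img i U x -> {for x, continuous w}) ->
  open [set q | U q /\ G (phi i q, w (phi i q))].
Proof.
move=> oU Ui oG cw; rewrite openE => q [Uq Gq].
have iq := Ui _ Uq.
have c1 : phi i @ q --> phi i q by exact: cmap_cont.
have c2 : w x @[x --> phi i q] --> w (phi i q).
  by apply: cw; exact: chart_img_phi.
have c3 : w (phi i x) @[x --> q] --> w (phi i q) by exact: cvg_comp c1 c2.
have N1 := open_nbhs_nbhs (conj oU Uq).
have N2 : nbhs q [set x | G (phi i x, w (phi i x))].
  by apply: (cvg_pair c1 c3); exact: (open_nbhs_nbhs (conj oG Gq)).
by apply: filterS2 N1 N2 => x Ux Gx; split.
Qed.

Lemma smooth_field0 U : smooth_field U (fun=> 0 : 'rV[R]_n).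
Proof.
move=> k; rewrite (_ : (fun x => _) = fun=> 0); first exact: smooth_cst.
by apply/funext => x /=; rewrite linear0.
Qed.

Lemma smooth_fieldD U E E' : open U -> smooth_field U E -> smooth_field U E' ->
  smooth_field U (fun q => E q + E' q).
Proof.
move=> oU S S' k; have oC := @open_chart_img k U oU.
rewrite (_ : (fun x => _) = fun x => rep k E x + rep k E' x).
  exact: (smooth_add oC (S k) (S' k)).
by apply/funext => x /=; rewrite linearD.
Qed.

Lemma smooth_fieldZ U (f : M -> R) E : open U -> smooth_fun U f ->
  smooth_field U E -> smooth_field U (fun q => f q *: E q).
Proof.
move=> oU S S' k; have oC := @open_chart_img k U oU.
rewrite (_ : (fun x => _) = fun x => (f \o psi k) x *: rep k E x).
  exact: (smooth_scale oC (S k) (S' k)).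
by apply/funext => x /=; rewrite linearZ.
Qed.

Lemma smooth_field_sub U U' E : U' `<=` U -> smooth_field U E -> smooth_field U' E.
Proof. by move=> s S k; apply: smooth_sub (S k); exact: chart_img_sub. Qed.

Lemma smooth_field_tvec i U w : open U -> U `<=` dom i ->
  smooth (chart_img i U) w -> smooth_field U (fun q => tvec i q (w (phi i q))).
Proof.
move=> oU Ui Sw; apply: (smooth_field_chart oU Ui).
apply: smooth_ext Sw; first exact: open_chart_img.
by move=> x /chart_imgP[Ux ix e]; rewrite /rep e tvecK.
Qed.

Lemma smooth_const_ext q v : smooth_field (dom (mat q)) (const_ext q v).
Proof.
apply: (@smooth_field_tvec (mat q) _ (fun=> v)) => //; first exact: cdom_open.
exact: smooth_cst.
Qed.

Lemma const_ext_id q v : const_ext q v q = v.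
Proof. exact: tvec_id. Qed.

End Charts.

(** * Connections in a chart *)

Section Connection.
Context {R : realType} {n : nat} {M : manifold R n}.
Variables (Adm : M -> set 'rV[R]_n)
  (nabla : (M -> 'rV[R]_n) -> (M -> 'rV[R]_n) -> M -> 'rV[R]_n -> 'rV[R]_n).
Hypothesis conn : aconnection Adm nabla.
Variable i : mindex M.
Implicit Types (q : M) (U : set M) (E H : M -> 'rV[R]_n).
Local Notation dom i := (cdom (mchart i)).
Local Notation phi i := (cmap (mchart i)).
Local Notation psi i := (cinv (mchart i)).

Definition frame (j : 'I_n) : M -> 'rV[R]_n :=
  fun q => tvec i q (delta_mx ord0 j).

Lemma smooth_frame U j : open U -> U `<=` dom i -> smooth_field U (frame j).
Proof.
move=> oU Ui; apply: (@smooth_field_tvec _ _ _ i U (fun=> delta_mx ord0 j)) => //.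
exact: smooth_cst.
Qed.

(** The Christoffel symbols of an anisotropic connection are functions on the tangent bundle, not
    only of the base point. *)
Definition Gamma (k j : 'I_n) (z : 'rV[R]_n * 'rV[R]_n) : 'rV[R]_n :=
  let q := psi i z.1 in
  tcoord i q (nabla (frame k) (frame j) q (tvec i q z.2)).

Lemma smooth_Gamma k j : smooth (tchart_img i Adm) (Gamma k j).
Proof.
have oi := @cdom_open _ _ _ (mchart i).
have Sf a := smooth_frame a oi (@subset_refl _ _).
have [S _ _ _] := conn oi (Sf k) (Sf k) (Sf j) (Sf j).
by apply: smooth_sub (S i) => z [c a]; split=> //; have [] := chart_imgP c.
Qed.

Lemma nabla_ext U E E' H H' q z : open U -> U q -> Adm q z ->
  smooth_field U E -> smooth_field U E' -> smooth_field U H ->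
  smooth_field U H' -> (forall q, U q -> E q = E' q) ->
  (forall q, U q -> H q = H' q) -> nabla E H q z = nabla E' H' q z.
Proof.
move=> oU Uq Az SE SE' SH SH' eE eH.
have [_ loc _ _] := conn oU SE SE' SH SH'.
by apply: loc => // a Ua; rewrite eE // eH.
Qed.

Lemma nabla0l U H q z : open U -> U q -> Adm q z -> smooth_field U H ->
  nabla (fun=> 0) H q z = 0.
Proof.
move=> oU Uq Az SH; have S0 := @smooth_field0 R n M U.
have [_ _ /(_ q z Uq Az)[e _] _] := conn oU S0 S0 SH SH.
have z0 : (fun=> 0 + 0) = (fun=> 0) :> (M -> 'rV[R]_n).
  by apply/funext => a; rewrite addr0.
by apply: (@addrI _ (nabla (fun=> 0) H q z)); rewrite addr0 -e z0.
Qed.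

Lemma nabla0r U E q z : open U -> U q -> Adm q z -> smooth_field U E ->
  nabla E (fun=> 0) q z = 0.
Proof.
move=> oU Uq Az SE; have S0 := @smooth_field0 R n M U.
have [_ _ /(_ q z Uq Az)[_ e] _] := conn oU SE SE S0 S0.
have z0 : (fun=> 0 + 0) = (fun=> 0) :> (M -> 'rV[R]_n).
  by apply/funext => a; rewrite addr0.
by apply: (@addrI _ (nabla E (fun=> 0) q z)); rewrite addr0 -e z0.
Qed.

Section Sums.
Variables (U : set M) (f : 'I_n -> M -> R).
Hypotheses (oU : open U) (Ui : U `<=` dom i).
Hypothesis Sf : forall k, smooth_fun U (f k).

Lemma smooth_frame_sum (s : seq 'I_n) :
  smooth_field U (fun q => \sum_(k <- s) f k q *: frame k q).
Proof.
elim: s => [|k s IH].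
  rewrite (_ : (fun q => _) = fun=> 0); first exact: smooth_field0.
  by apply/funext => q; rewrite big_nil.
rewrite (_ : (fun q => _) =
    fun q => f k q *: frame k q + \sum_(j <- s) f j q *: frame j q).
  apply: smooth_fieldD => //; apply: smooth_fieldZ => //; exact: smooth_frame.
by apply/funext => q; rewrite big_cons.
Qed.

Lemma nabla_suml (s : seq 'I_n) H q z : U q -> Adm q z -> smooth_field U H ->
  nabla (fun q => \sum_(k <- s) f k q *: frame k q) H q z =
  \sum_(k <- s) f k q *: nabla (frame k) H q z.
Proof.
move=> Uq Az SH; elim: s => [|k s IH].
  rewrite big_nil (_ : (fun q => _) = fun=> 0); first exact: nabla0l SH.
  by apply/funext => a; rewrite big_nil.
rewrite (_ : (fun q => _) =
    fun q => f k q *: frame k q + \sum_(j <- s) f j q *: frame j q); last first.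
  by apply/funext => a; rewrite big_cons.
have Sk := smooth_frame k oU Ui; have Sfk := smooth_fieldZ oU (Sf k) Sk.
have Ss := smooth_frame_sum s.
have [_ _ /(_ q z Uq Az)[-> _] _] := conn oU Sfk Ss SH SH.
have [_ _ _ /(_ _ (Sf k) q z Uq Az)[-> _]] := conn oU Sk Sk SH SH.
by rewrite big_cons IH.
Qed.

Lemma nabla_sumr (s : seq 'I_n) E q z : U q -> Adm q z -> smooth_field U E ->
  nabla E (fun q => \sum_(k <- s) f k q *: frame k q) q z =
  \sum_(k <- s) (dir_der q (E q) (f k) *: frame k q +
                 f k q *: nabla E (frame k) q z).
Proof.
move=> Uq Az SE; elim: s => [|k s IH].
  rewrite big_nil (_ : (fun q => _) = fun=> 0); first exact: nabla0r SE.
  by apply/funext => a; rewrite big_nil.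
rewrite (_ : (fun q => _) =
    fun q => f k q *: frame k q + \sum_(j <- s) f j q *: frame j q); last first.
  by apply/funext => a; rewrite big_cons.
have Sk := smooth_frame k oU Ui; have Sfk := smooth_fieldZ oU (Sf k) Sk.
have Ss := smooth_frame_sum s.
have [_ _ /(_ q z Uq Az)[_ ->] _] := conn oU SE SE Sfk Ss.
have [_ _ _ /(_ _ (Sf k) q z Uq Az)[_ ->]] := conn oU SE SE Sk Sk.
by rewrite big_cons IH.
Qed.

End Sums.

Definition component E (j : 'I_n) q : R := tcoord i q (E q) ord0 j.

Lemma smooth_comp_fun U E j : open U -> U `<=` dom i -> smooth_field U E ->
  smooth_fun U (component E j).
Proof.
move=> oU Ui SE; apply: (smooth_fun_chart oU Ui).
have oC := @open_chart_img _ _ _ i U oU.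
exact: (smooth_coord ord0 j oC (SE i)).
Qed.

Lemma comp_sum E q : dom i q -> E q = \sum_j component E j q *: frame j q.
Proof.
move=> iq; rewrite -[LHS](tcoordK _ iq) [in LHS](row_sum_delta (tcoord i q (E q))).
by rewrite linear_sum; apply: eq_bigr => j _; rewrite linearZ.
Qed.

(** On [U] both fields coincide with their expansions in the coordinate frame, and locality of the
    connection allows the replacement. The Leibniz rule then produces the derivative of the
    components of H, and linearity leaves the values of nabla on the frame. *)
Lemma nabla_chart U E H q z : open U -> U `<=` dom i -> U q -> Adm q z ->
  smooth_field U E -> smooth_field U H ->
  tcoord i q (nabla E H q z) =
  'd (rep i H) (phi i q) (tcoord i q (E q)) +
  christoffel Gamma (phi i q, tcoord i q z) (tcoord i q (E q)) (tcoord i q (H q)).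
Proof.
move=> oU Ui Uq Az SE SH; have iq := Ui _ Uq.
pose EE q := \sum_k component E k q *: frame k q.
pose HH q := \sum_j component H j q *: frame j q.
have SCE k := smooth_comp_fun k oU Ui SE.
have SCH k := smooth_comp_fun k oU Ui SH.
have SEE : smooth_field U EE by exact: smooth_frame_sum.
have SHH : smooth_field U HH by exact: smooth_frame_sum.
have -> : nabla E H q z = nabla E HH q z.
  by apply: (nabla_ext oU) => // a Ua; apply: comp_sum; exact: Ui.
rewrite /HH (nabla_sumr oU Ui) // linear_sum.
have dH : differentiable (rep i H) (phi i q).
  by apply: (smooth_differentiable (SH i)); exact: chart_img_phi.
have -> : 'd (rep i H) (phi i q) (tcoord i q (E q)) =
   \sum_j dir_der q (E q) (component H j) *: delta_mx ord0 j.
  rewrite [LHS]row_sum_delta; apply: eq_bigr => j _; congr (_ *: _).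
  have [d e] := diff_rcoord (tcoord i q (E q)) j dH.
  by rewrite (dir_der_chart (f := component H j) (E q) iq d); symmetry; exact: e.
rewrite /christoffel exchange_big -big_split; apply: eq_bigr => j _.
rewrite linearD !linearZ /= /frame tvecK //; congr (_ + _).
have -> : nabla E (frame j) q z = nabla EE (frame j) q z.
  by apply: (nabla_ext oU) => // [||a Ua]; try exact: smooth_frame; apply: comp_sum; exact: Ui.
rewrite /EE (nabla_suml oU Ui) //; last exact: smooth_frame.
rewrite linear_sum scaler_sumr; apply: eq_bigr => k _.
by rewrite linearZ scalerA mulrC /Gamma /= cmapK // tcoordK.
Qed.

Definition arep (X : M -> 'rV[R]_n -> 'rV[R]_n) (z : 'rV[R]_n * 'rV[R]_n) :=
  let q := psi i z.1 in tcoord i q (X q (tvec i q z.2)).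

(** Let u be the derivative along b of the components of the extension V. The derivative of X(V) is
    taken along (b, u), and the fiber derivative along (0, u + Gamma(b, z)); the difference of the
    two directions is the horizontal lift of b, and u disappears. *)
Lemma cov_afield_chart (G : set ('rV[R]_n * 'rV[R]_n)) X q z b :
  open G -> G `<=` tchart_img i Adm -> smooth G (arep X) ->
  dom i q -> G (phi i q, tcoord i q z) ->
  tcoord i q (cov_afield nabla q z b X) =
  lcov Gamma (arep X) (phi i q, tcoord i q z) (tcoord i q b).
Proof.
move=> oG GA SX iq Gz.
have Az : Adm q z by have [_] := GA _ Gz; rewrite /= cmapK // tcoordK.
pose V := const_ext q z; pose U0 := dom i `&` dom (mat q).
have oU0 : open U0 by apply: openI; exact: cdom_open.
have SV0 : smooth_field U0 V.
  by apply: smooth_field_sub (smooth_const_ext q z) => a [].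
have Sb0 : smooth_field U0 (const_ext q b).
  by apply: smooth_field_sub (smooth_const_ext q b) => a [].
have U0i : U0 `<=` dom i by move=> a [].
have U0q : U0 q by split=> //; exact: mat_dom.
(* Over this smaller neighbourhood V stays in [G], where [arep X] is smooth. *)
pose U := [set a | U0 a /\ G (phi i a, rep i V (phi i a))].
have oU : open U.
  apply: open_section => // x Cx; apply: differentiable_continuous.
  exact: (smooth_differentiable (SV0 i)).
have UU0 : U `<=` U0 by move=> a [].
have Ui : U `<=` dom i by move=> a /UU0/U0i.
have repVq : rep i V (phi i q) = tcoord i q z.
  by rewrite /rep cmapK // /V const_ext_id.
have Uq : U q by split=> //; rewrite repVq.
have SV := smooth_field_sub UU0 SV0; have Sb := smooth_field_sub UU0 Sb0.
have oC := @open_chart_img _ _ _ i U oU.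
have Spair : smooth (chart_img i U) (fun x => (x, rep i V x)).
  by apply: smooth_pair => //; exact: smooth_id.
have repXV x : chart_img i U x ->
    arep X (x, rep i V x) = rep i (fun a => X a (V a)) x.
  by move=> /chart_imgP[Ux ix e]; rewrite /arep /rep /= tcoordK.
have SrX : smooth (chart_img i U) (fun x => arep X (x, rep i V x)).
  apply: (@smooth_comp _ _ _ _ _ G (fun x => (x, rep i V x)) (arep X)) => //.
    by apply: finite_coords_prod; exact: finite_coords_rV.
  by move=> x /chart_imgP[[_ Gx] ix e]; rewrite e in Gx.
have SXV : smooth_field U (fun a => X a (V a)).
  by apply: (smooth_field_chart oU Ui); exact: smooth_ext SrX.
have dX := smooth_differentiable SX Gz.
have Cq : chart_img i U (phi i q) by exact: chart_img_phi.
have dV : differentiable (rep i V) (phi i q).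
  exact: (smooth_differentiable (SV i)).
set zeta := (phi i q, tcoord i q z) in dX *.
pose bh := tcoord i q b; pose u := 'd (rep i V) (phi i q) bh.
have H1 : tcoord i q (cov nabla q z b (fun a => X a (V a))) =
   'd (arep X) zeta (bh, u) + christoffel Gamma zeta bh (arep X zeta).
  rewrite /cov (nabla_chart oU) // const_ext_id; apply: (f_equal2 +%R).
    have dp : differentiable (fun x => (x, rep i V x)) (phi i q).
      exact: (smooth_differentiable Spair).
    have dX' : differentiable (arep X) (phi i q, rep i V (phi i q)).
      by rewrite repVq.
    have E : \forall x \near phi i q,
        arep X (x, rep i V x) = rep i (fun a => X a (V a)) x.
      by apply: filterS (near_chart oU Uq iq) => x /repXV.
    have d := differentiable_comp dp dX'.
    have [_ _ e] := near_eq_diff E d.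
    transitivity ('d (fun x => arep X (x, rep i V x)) (phi i q) bh).
      exact: (congr1 (fun f => f bh) e).
    transitivity ('d (arep X) (phi i q, rep i V (phi i q))
        ('d (fun x => (x, rep i V x)) (phi i q) bh)).
      exact: (diff_comp_at bh dp dX').
    rewrite repVq; apply: (f_equal ('d (arep X) zeta)).
    have did : differentiable (fun y : 'rV[R]_n => y) (phi i q).
      exact: (@ex_diff _ _ _ _ _ _ _ (is_diff_id (phi i q))).
    transitivity ('d (fun y : 'rV[R]_n => y) (phi i q) bh, u).
      exact: (congr1 (fun f => f bh) (diff_pair did dV)).
    apply: (f_equal2 pair); last exact: erefl.
    exact: (congr1 (fun f => f bh) (@diff_val _ _ _ _ _ _ _ (is_diff_id (phi i q)))).
  by apply: (f_equal (christoffel Gamma zeta bh)); rewrite /arep /zeta /= cmapK // tcoordK // /V const_ext_id.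
have H2 : tcoord i q (cov nabla q z b V) =
   u + christoffel Gamma zeta bh (tcoord i q z).
  by rewrite /cov (nabla_chart oU) // /V !const_ext_id.
(* On the fiber over q, X is [arep X] conjugated by the linear isomorphisms [tcoord] and [tvec];
   this holds for every vector of the fiber, so no restriction to admissible vectors enters the
   derivative. *)
have H3 c : tcoord i q ('D_c (X q) z) = 'd (arep X) zeta (0, tcoord i q c).
  have ct := tcoord_continuous iq; have cv := tvec_continuous iq.
  pose pr (y : 'rV[R]_n) := (phi i q, tcoord i q y).
  have dt := linear_differentiable z ct.
  have dcst : differentiable (fun=> phi i q : 'rV[R]_n) z by exact: differentiable_cst.
  have dp : differentiable pr z by exact: differentiable_pair.
  have Eq : X q = fun y => tvec i q (arep X (pr y)).
    by apply/funext => y; rewrite /arep /pr /= cmapK // !tcoordK.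
  have d1 : differentiable (fun y => arep X (pr y)) z.
    exact: (differentiable_comp dp dX).
  have d2 := linear_differentiable (arep X (pr z)) cv.
  have d3 : differentiable (X q) z by rewrite Eq; exact: (differentiable_comp d1 d2).
  rewrite deriveE //.
  transitivity (tcoord i q (tvec i q ('d (arep X) zeta (0, tcoord i q c)))).
    apply: (f_equal (tcoord i q)).
    transitivity ('d (fun y => tvec i q (arep X (pr y))) z c).
      exact: (congr1 (fun F : _ -> 'rV[R]_n => 'd F z c) Eq).
    transitivity ('d (tvec i q) (arep X (pr z)) ('d (fun y => arep X (pr y)) z c)).
      exact: (diff_comp_at c d1 d2).
    transitivity (tvec i q ('d (fun y => arep X (pr y)) z c)).
      exact: (congr1 (fun f => f _) (diff_lin (arep X (pr z)) cv)).
    apply: (f_equal (tvec i q)).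
    transitivity ('d (arep X) (pr z) ('d pr z c)).
      exact: (diff_comp_at c dp dX).
    apply: (f_equal ('d (arep X) zeta)).
    transitivity ('d (fun=> phi i q : 'rV[R]_n) z c, 'd (tcoord i q) z c).
      exact: (congr1 (fun f => f c) (diff_pair dcst dt)).
    apply: (f_equal2 pair).
      exact: (congr1 (fun f => f c) (diff_cst (phi i q) z)).
    exact: (congr1 (fun f => f c) (diff_lin z ct)).
  exact: tvecK.
rewrite lcovE /cov_afield (linearB (tcoord i q)) /= H1 H3 H2.
rewrite addrAC -(linearB ('d (arep X) zeta)).
apply: (f_equal2 +%R); last exact: erefl.
apply: (f_equal ('d (arep X) zeta)); rewrite /hlift /=; apply: (f_equal2 pair); first exact: subr0.
change (u - (u + christoffel Gamma zeta bh (tcoord i q z)) =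
  - christoffel Gamma zeta bh (tcoord i q z)).
by rewrite opprD addrA subrr add0r.
Qed.

End Connection.

(** * Horizontal and vertical projections in a chart *)

Section LinearAlgebra.
Context {R : realType}.

Lemma linear_row_sum n (W : lmodType R) (f : 'rV[R]_n -> W) u : linear f ->
  f u = \sum_b u ord0 b *: f (delta_mx ord0 b).
Proof.
move=> lf; pose F : {linear 'rV[R]_n -> W} :=
  HB.pack f (GRing.isLinear.Build R 'rV[R]_n W _ f lf).
rewrite [in LHS](row_sum_delta u); rewrite -[f _]/(F _) linear_sum.
by apply: eq_bigr => b _; rewrite linearZ.
Qed.

Lemma unitmx_inj n (A : 'M[R]_n) :
  (forall u : 'rV[R]_n, u *m A = 0 -> u = 0) -> A \in unitmx.
Proof.
move=> H; rewrite -row_free_unit -kermx_eq0; apply/eqP/row_matrixP => r.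
by rewrite row0; apply: H; rewrite -row_mul mulmx_ker row0.
Qed.

(** A directional derivative only sees the function on one line, so it is transported by equality
    along matching lines, without any differentiability. *)
Lemma derive_reparam (V V' W : normedModType R) (f : V -> W) (g : V' -> W)
    a a' w w' :
  (forall h : R, f (h *: w + a) = g (h *: w' + a')) ->
  'D_w f a = 'D_w' g a'.
Proof.
move=> H; have H0 := H 0; rewrite !scale0r !add0r in H0.
rewrite /derive; have -> // :
  (fun h : R => h^-1 *: ((f \o shift a) (h *: w) - f a)) =
  (fun h : R => h^-1 *: ((g \o shift a') (h *: w') - g a')).
by apply/funext => h; rewrite H0 /= H.
Qed.

End LinearAlgebra.

(** * The differential of the submersion in charts *)

Section Submersion.
Context {R : realType} {n m : nat} {M : manifold R n} {B : manifold R m}.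
Variable sigma : M -> B.
Hypothesis sm : smooth_map sigma.
Variables (i : mindex M) (j : mindex B).
Implicit Types (q : M).
Local Notation dom i := (cdom (mchart i)).
Local Notation phi i := (cmap (mchart i)).
Local Notation psi i := (cinv (mchart i)).

Definition sloc (i : mindex M) (j : mindex B) : 'rV[R]_n -> 'rV[R]_m :=
  fun x => phi j (sigma (psi i x)).

Lemma open_sigma k : open (sigma @^-1` dom k).
Proof.
by have [c _] := sm; apply: open_comp => [q _|]; [exact: c|exact: cdom_open].
Qed.

Lemma smooth_sloc k l U : U `<=` sigma @^-1` dom l ->
  smooth (chart_img k U) (sloc k l).
Proof. by have [_ S] := sm => Us; apply: smooth_sub (S k l); exact: chart_img_sub. Qed.

Lemma sloc_differentiable k l q : dom k q -> dom l (sigma q) ->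
  differentiable (sloc k l) (phi k q).
Proof.
move=> kq lq.
have S := @smooth_sloc k l (sigma @^-1` dom l) (@subset_refl _ _).
by apply: (smooth_differentiable S); exact: chart_img_phi.
Qed.

(** [tmap] is computed in the charts chosen at q and at [sigma q]; transition maps on both sides
    lead to the fixed charts i and j. *)
Lemma sloc_diff q y : dom i q -> dom j (sigma q) ->
  'd (sloc i j) (phi i q) y = tcoord j (sigma q) (tmap sigma q (tvec i q y)).
Proof.
move=> iq jq; rewrite /tmap /chart_at tvecE tcoordE.
set k := mat q; set l := mat (sigma q).
have kq : dom k q by exact: mat_dom.
have lq : dom l (sigma q) by exact: mat_dom.
have oU : open (dom k `&` sigma @^-1` dom l).
  by apply: openI; [exact: cdom_open|exact: open_sigma].
have N := near_chart oU (conj kq lq) iq.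
have E : \forall x \near phi i q,
    tr l j (sloc k l (tr i k x)) = sloc i j x.
  apply: filterS N => x /chart_imgP[[kx lx] ix e].
  by rewrite /tr /sloc (cmapK kx) (cmapK lx).
have e1 : tr i k (phi i q) = phi k q by rewrite /tr (cmapK iq).
have e2 : sloc k l (phi k q) = phi l (sigma q) by rewrite /sloc (cmapK kq).
have d1 := tr_differentiable iq kq.
have d2 : differentiable (sloc k l) (tr i k (phi i q)).
  by rewrite e1; exact: sloc_differentiable.
have d3 : differentiable (tr l j) (sloc k l (tr i k (phi i q))).
  by rewrite e1 e2; exact: tr_differentiable.
have d12 : differentiable (fun x => sloc k l (tr i k x)) (phi i q).
  exact: (differentiable_comp d1 d2).
have d : differentiable (fun x => tr l j (sloc k l (tr i k x))) (phi i q).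
  exact: (differentiable_comp d12 d3).
have [_ _ e] := near_eq_diff E d.
rewrite !tchangeE.
transitivity ('d (fun x => tr l j (sloc k l (tr i k x))) (phi i q) y).
  exact: (congr1 (fun f => f y) e).
transitivity ('d (tr l j) (sloc k l (tr i k (phi i q)))
   ('d (fun x => sloc k l (tr i k x)) (phi i q) y)).
  exact: (diff_comp_at y d12 d3).
transitivity ('d (tr l j) (sloc k l (tr i k (phi i q)))
   ('d (sloc k l) (tr i k (phi i q)) ('d (tr i k) (phi i q) y))).
  apply: (f_equal ('d (tr l j) (sloc k l (tr i k (phi i q))))).
  exact: (diff_comp_at y d1 d2).
transitivity ('d (tr l j) (sloc k l (phi k q))
   ('d (sloc k l) (phi k q) ('d (tr i k) (phi i q) y))).
  exact: (congr1 (fun x => 'd (tr l j) (sloc k l x)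
   ('d (sloc k l) x ('d (tr i k) (phi i q) y))) e1).
exact: (congr1 (fun x => 'd (tr l j) x
   ('d (sloc k l) (phi k q) ('d (tr i k) (phi i q) y))) e2).
Qed.

Fact slocmx_subproof : {F : 'rV[R]_n -> 'M[R]_(n, m) |
  forall x, F x = lin1_mx ('d (sloc i j) x)}.
Proof. by exists (fun x => lin1_mx ('d (sloc i j) x)). Qed.

Definition slocmx := sval slocmx_subproof.

Lemma slocmxE x (y : 'rV[R]_n) : y *m slocmx x = 'd (sloc i j) x y.
Proof. by rewrite /slocmx (svalP slocmx_subproof) mul_rV_lin1. Qed.

Lemma smooth_slocmx :
  smooth_mx (chart_img i (sigma @^-1` dom j)) slocmx.
Proof.
move=> a c; have oC := @open_chart_img _ _ _ i _ (open_sigma j).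
have S := @smooth_sloc i j _ (@subset_refl _ (sigma @^-1` dom j)).
apply: (@smooth_ext _ _ _ _
   (fun x => 'D_(delta_mx ord0 a) (sloc i j) x ord0 c)) => // [x Cx|].
  have d := smooth_differentiable S Cx.
  by rewrite deriveE // -slocmxE -rowE mxE.
by apply: smooth_coord => //; exact: smooth_derive.
Qed.

Lemma vertical_chart q (y : 'rV[R]_n) : dom i q -> dom j (sigma q) ->
  vertical sigma q (tvec i q y) <-> y *m slocmx (phi i q) = 0.
Proof.
move=> iq jq; rewrite slocmxE sloc_diff // /vertical; split=> [->|e].
  by rewrite linear0.
by rewrite -[LHS](tcoordK _ jq) e linear0.
Qed.

Lemma slocmx_surj q c : (forall y, exists v, tmap sigma q v = y) ->
  dom i q -> dom j (sigma q) -> exists y : 'rV[R]_n, y *m slocmx (phi i q) = c.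
Proof.
move=> surj iq jq; have [v e] := surj (tvec j (sigma q) c).
exists (tcoord i q v); rewrite slocmxE sloc_diff // (tcoordK _ iq) e.
by rewrite tvecK.
Qed.

End Submersion.

(** * The fundamental tensor in a chart *)

Section Fundamental.
Context {R : realType} {n : nat} {M : manifold R n}.
Variables (Adm : M -> set 'rV[R]_n) (L : M -> 'rV[R]_n -> R).
Hypothesis finslerM : pseudo_finsler Adm L.
Variable i : mindex M.
Implicit Types (q : M) (x y e h : 'rV[R]_n) (z : 'rV[R]_n * 'rV[R]_n).
Local Notation dom i := (cdom (mchart i)).
Local Notation phi i := (cmap (mchart i)).
Local Notation psi i := (cinv (mchart i)).
Local Notation O := (tchart_img i Adm).

Definition Lloc z : R := L (psi i z.1) (tvec i (psi i z.1) z.2).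

Lemma open_O : open O. Proof. by case: finslerM => H _ _ _ _; exact: H. Qed.

Lemma smooth_Lloc : smooth O Lloc.
Proof. by case: finslerM => _ _ _ H _; exact: H. Qed.

Definition vdir e : 'rV[R]_n * 'rV[R]_n := (0, e).

Lemma vdir_linear : linear vdir.
Proof.
by move=> a u v; rewrite /vdir; congr pair; rewrite /= scaler0 addr0.
Qed.

HB.instance Definition _ := GRing.isLinear.Build R 'rV[R]_n
  ('rV[R]_n * 'rV[R]_n)%type _ vdir vdir_linear.

Lemma vdir_shift (t : R) e z : t *: vdir e + z = (z.1, t *: e + z.2).
Proof. by case: z => x y; congr pair; rewrite /= scaler0 add0r. Qed.

Lemma derive_Lloc e z :
  'D_(vdir e) Lloc z =
  'D_(tvec i (psi i z.1) e) (L (psi i z.1)) (tvec i (psi i z.1) z.2).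
Proof.
apply: derive_reparam => t.
by rewrite vdir_shift /Lloc /= linearP.
Qed.

Lemma fund_Lloc q x y e h : psi i x = q ->
  fund L q (tvec i q y) (tvec i q e) (tvec i q h) =
  2^-1 * 'D_(vdir e) ('D_(vdir h) Lloc) (x, y).
Proof.
move=> <-; rewrite /fund; apply: (f_equal ( *%R 2^-1)); symmetry.
apply: derive_reparam => t.
by rewrite vdir_shift derive_Lloc /= linearP.
Qed.

Fact fundmx_subproof : {F : 'rV[R]_n * 'rV[R]_n -> 'M[R]_n | forall z a b,
  F z a b = 2^-1 * 'D_(vdir (delta_mx ord0 a)) ('D_(vdir (delta_mx ord0 b)) Lloc) z}.
Proof.
exists (fun z => \matrix_(a, b) (2^-1 *
  'D_(vdir (delta_mx ord0 a)) ('D_(vdir (delta_mx ord0 b)) Lloc) z)).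
by move=> z a b; rewrite mxE.
Qed.

Definition fundmx := sval fundmx_subproof.

Lemma fundmxE z a b : fundmx z a b =
  2^-1 * 'D_(vdir (delta_mx ord0 a)) ('D_(vdir (delta_mx ord0 b)) Lloc) z.
Proof. exact: (svalP fundmx_subproof). Qed.

Lemma smooth_fundmx : smooth_mx O fundmx.
Proof.
have oO := open_O.
move=> a b; apply: (@smooth_ext _ _ _ _ (fun z => 2^-1 *
    'D_(vdir (delta_mx ord0 a)) ('D_(vdir (delta_mx ord0 b)) Lloc) z)) => //.
  by move=> z _; rewrite fundmxE.
apply: smooth_mul => //; first exact: smooth_cst.
by do 2!apply: smooth_derive; exact: smooth_Lloc.
Qed.

(** A directional derivative is linear in its direction where the function is differentiable. The
    inner derivative must be expanded on a whole neighbourhood of z before it is differentiated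
    again, the outer one at z alone. *)
Lemma derive2_Lloc e h z : O z ->
  2^-1 * 'D_(vdir e) ('D_(vdir h) Lloc) z =
  \sum_a \sum_b e ord0 a * (h ord0 b * fundmx z a b).
Proof.
move=> Oz; have oO := open_O; have SL := smooth_Lloc.
have S2 u := smooth_derive (vdir u) SL.
have d2 u : differentiable ('D_(vdir u) Lloc) z.
  exact: smooth_differentiable (S2 u) Oz.
have lin (f : _ -> R) : differentiable f z -> linear (fun u : 'rV[R]_n => 'd f z (vdir u)).
  by move=> df a u' v; rewrite vdir_linear linearP.
transitivity (2^-1 * \sum_a e ord0 a *: 'D_(vdir (delta_mx ord0 a)) ('D_(vdir h) Lloc) z).
  apply: (f_equal ( *%R 2^-1)); rewrite deriveE //.
  rewrite (linear_row_sum e (lin _ (d2 h))).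
  by apply: eq_bigr => a _; rewrite deriveE.
rewrite mulr_sumr; apply: eq_bigr => a _; pose w := vdir (delta_mx ord0 a).
have E : 'D_w ('D_(vdir h) Lloc) z =
   'D_w (\sum_b (h ord0 b *: 'D_(vdir (delta_mx ord0 b)) Lloc)) z.
  apply: near_eq_derive.
  apply: filterS (open_nbhs_nbhs (conj oO Oz)) => y Oy.
  have dy := smooth_differentiable SL Oy.
  have ly : linear (fun u : 'rV[R]_n => 'd Lloc y (vdir u)).
    by move=> c u' v; rewrite vdir_linear linearP.
  rewrite deriveE // (linear_row_sum h ly) fct_sumE.
  by apply: eq_bigr => b _; rewrite -deriveE.
have db b : derivable ('D_(vdir (delta_mx ord0 b)) Lloc) z w by exact: diff_derivable.
have {}E : 'D_w ('D_(vdir h) Lloc) z =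
   \sum_b 'D_w (h ord0 b *: 'D_(vdir (delta_mx ord0 b)) Lloc) z.
  by apply: (etrans E); apply: derive_sum => b; exact: derivableZ.
apply: (etrans (f_equal (fun t => 2^-1 * (e ord0 a * t)) E)).
rewrite -mulr_sumr mulrCA; apply: (f_equal ( *%R (e ord0 a))).
rewrite mulr_sumr; apply: eq_bigr => b _.
by rewrite deriveZ // fundmxE mulrCA.
Qed.

Lemma fund_chart q y e h : dom i q -> Adm q (tvec i q y) ->
  fund L q (tvec i q y) (tvec i q e) (tvec i q h) =
  (e *m fundmx (phi i q, y) *m h^T) ord0 ord0.
Proof.
move=> iq Ay; have Oz : O (phi i q, y).
  by split=> /=; [exact: chart_img_phi|rewrite cmapK].
apply: (etrans (fund_Lloc y e h (cmapK iq))).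
apply: (etrans (derive2_Lloc e h Oz)); rewrite exchange_big mxE.
apply: eq_bigr => b _; rewrite !mxE mulr_suml; apply: eq_bigr => a _.
by rewrite mulrA mulrAC.
Qed.

Lemma fundmx_unit z : O z -> fundmx z \in unitmx.
Proof.
case: z => x y [/= Cx Axy]; have [_ iq e] := chart_imgP Cx.
apply: unitmx_inj => u u0; case: finslerM => _ _ _ _ nd.
apply: (can_inj (@tvecK _ _ _ i (psi i x)^~ iq)).
rewrite linear0; apply: (nd _ _ Axy) => h.
by rewrite -(tcoordK h iq) fund_chart // e u0 mul0mx mxE.
Qed.

(** * Matrices of the horizontal and vertical projections *)

Section Projectors.
Context {m : nat} {B : manifold R m}.
Variable sigma : M -> B.
Hypotheses (sm : smooth_map sigma)
  (surj : forall p (c : 'rV[R]_m), exists v, tmap sigma p v = c)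
  (nondeg : vertical_nondegenerate sigma Adm L).
Variable j : mindex B.

(** The coordinates of admissible vectors whose base point has its image in the chart j: the
    differential of the submersion and g_v both have matrices there. *)
Definition adapted z : Prop := O z /\ chart_img i (sigma @^-1` dom j) z.1.

Lemma adapted_sub : adapted `<=` O. Proof. by move=> z []. Qed.

Lemma open_adapted : open adapted.
Proof.
apply: openI; first exact: open_O.
apply: (@open_comp _ _ fst); first by move=> z _; exact: cvg_fst.
by apply: open_chart_img; exact: open_sigma.
Qed.

Local Notation D x := (slocmx sigma i j x).

Lemma adapted_chart z : adapted z ->
  [/\ dom i (psi i z.1), phi i (psi i z.1) = z.1, dom j (sigma (psi i z.1)) &
      Adm (psi i z.1) (tvec i (psi i z.1) z.2)].
Proof. by move=> [[Cz Az] Sz]; have [] := chart_imgP Sz. Qed.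

Lemma fund_adapted z e h : adapted z ->
  fund L (psi i z.1) (tvec i (psi i z.1) z.2) (tvec i (psi i z.1) e)
    (tvec i (psi i z.1) h) = (e *m fundmx z *m h^T) ord0 ord0.
Proof.
move=> dz; have [iq e1 jq Az] := adapted_chart dz.
by rewrite fund_chart // e1 -surjective_pairing.
Qed.

Lemma vertical_adapted z y : adapted z ->
  vertical sigma (psi i z.1) (tvec i (psi i z.1) y) <-> y *m D z.1 = 0.
Proof.
move=> dz; have [iq e1 jq Az] := adapted_chart dz.
by have := vertical_chart sm y iq jq; rewrite e1.
Qed.

Lemma slocmx_adapted z c : adapted z -> exists y : 'rV[R]_n, y *m D z.1 = c.
Proof.
move=> dz; have [iq e1 jq Az] := adapted_chart dz.
by have := slocmx_surj sm c (surj _) iq jq; rewrite e1.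
Qed.

Lemma nondeg_adapted z (u : 'rV[R]_n) : adapted z -> u *m D z.1 = 0 ->
  (forall w : 'rV[R]_n, w *m D z.1 = 0 -> u *m fundmx z *m w^T = 0) -> u = 0.
Proof.
move=> dz u0 H; have [iq e1 jq Az] := adapted_chart dz.
apply: (can_inj (@tvecK _ _ _ i (psi i z.1)^~ iq)); rewrite linear0.
apply: (nondeg Az); first exact/(vertical_adapted _ dz).
move=> w vw; rewrite -(tcoordK w iq) fund_adapted //.
by rewrite H ?mxE //; apply/(vertical_adapted _ dz); rewrite tcoordK.
Qed.

(* A covector vanishing on the vertical space ker D is a row y D^T; hence the
   horizontal vectors are the rows y D^T G^-1, and the condition of having the
   same image as e under D determines y. *)
Definition grammx z : 'M[R]_m := (D z.1)^T *m invmx (fundmx z) *m D z.1.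

(** D is onto, so every basis vector is some w D, and pairing y with it reads off a component of y
    as y D^T w^T. *)
Lemma slocmx_tr_inj z (y : 'rV[R]_m) : adapted z -> y *m (D z.1)^T = 0 -> y = 0.
Proof.
move=> dz y0; apply/rowP => c; rewrite [RHS]mxE.
have [w ew] := slocmx_adapted (delta_mx ord0 c) dz.
have : (y *m (w *m D z.1)^T) ord0 ord0 = 0.
  by rewrite trmx_mul mulmxA y0 mul0mx mxE.
rewrite ew trmx_delta mxE (bigD1 c) //= big1 ?addr0 ?mxE ?eqxx ?mulr1 //.
by move=> k /negbTE kc; rewrite mxE kc mulr0.
Qed.

(** If y N = 0, then y D^T G^-1 is both vertical and orthogonal to the vertical space, hence zero by
    non-degeneracy; then y D^T = 0 and y = 0. *)
Lemma grammx_unit z : adapted z -> grammx z \in unitmx.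
Proof.
move=> dz; have uG := fundmx_unit (adapted_sub dz).
apply: unitmx_inj => y y0.
have x0 : y *m (D z.1)^T *m invmx (fundmx z) = 0.
  apply: (nondeg_adapted dz); first by rewrite /grammx !mulmxA in y0.
  move=> w w0; rewrite mulmxKV // -mulmxA -trmx_mul w0.
  by rewrite trmx0 mulmx0.
apply: (slocmx_tr_inj dz); rewrite -[LHS](mulmxKV uG).
by rewrite x0 mul0mx.
Qed.

(** It sends e to the horizontal vector with the same image as e under D. *)
Definition hmx z : 'M[R]_n :=
  D z.1 *m invmx (grammx z) *m (D z.1)^T *m invmx (fundmx z).

Definition vmx z : 'M[R]_n := 1%:M - hmx z.

Lemma hmxDvmx z : hmx z + vmx z = 1%:M.
Proof. by rewrite /vmx addrC subrK. Qed.

Lemma hmx_slocmx z : adapted z -> hmx z *m D z.1 = D z.1.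
Proof.
move=> dz; have uN := grammx_unit dz.
by rewrite /hmx -2!mulmxA [X in _ *m X]mulmxA -/(grammx z) mulmxKV.
Qed.

Lemma hmx_idem z : adapted z -> hmx z *m hmx z = hmx z.
Proof. by move=> dz; rewrite {2}/hmx !mulmxA hmx_slocmx. Qed.

Lemma hmx_vmx z : adapted z -> hmx z *m vmx z = 0.
Proof. by move=> dz; rewrite /vmx mulmxBr mulmx1 hmx_idem // subrr. Qed.

Lemma vmx_hmx z : adapted z -> vmx z *m hmx z = 0.
Proof. by move=> dz; rewrite /vmx mulmxBl mul1mx hmx_idem // subrr. Qed.

Lemma smooth_hmx : smooth_mx adapted hmx.
Proof.
have oD := open_adapted.
have SD : smooth_mx adapted (fun z => D z.1).
  move=> a c; have fc := @finite_coords_rV R n.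
  apply: (@smooth_comp _ _ _ _ _ (chart_img i (sigma @^-1` dom j)) fst
    (fun x => D x a c)) => //; first by move=> z [].
  - exact: smooth_fst.
  - exact: smooth_slocmx.
have SG : smooth_mx adapted (fun z => invmx (fundmx z)).
  apply: smooth_mx_inv => // [z /adapted_sub/fundmx_unit //|].
  exact: smooth_mx_sub adapted_sub smooth_fundmx.
have SDt := smooth_mx_tr oD SD.
have SN : smooth_mx adapted (fun z => invmx (grammx z)).
  apply: smooth_mx_inv => // [z /grammx_unit //|].
  by apply: smooth_mx_mul => //; exact: smooth_mx_mul.
by do 2![apply: smooth_mx_mul => //]; exact: smooth_mx_mul.
Qed.

Lemma smooth_vmx : smooth_mx adapted vmx.
Proof.
move=> a b; have oD := open_adapted.
apply: (@smooth_ext _ _ _ _ (fun z => (1%:M : 'M[R]_n) a b + (-1) * hmx z a b)) => //.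
  by move=> z _; rewrite /vmx [RHS]mxE [X in _ = _ + X]mxE mulN1r.
apply: smooth_add => //; first exact: smooth_cst.
by apply: smooth_mul => //; [exact: smooth_cst|exact: smooth_hmx].
Qed.

(** [xget] returns an unspecified candidate, so uniqueness is needed: the difference of two
    candidates is vertical, and also a difference of horizontal vectors, hence zero by
    non-degeneracy. *)
Lemma vpart_eq z e u : adapted z -> vertical sigma (psi i z.1) u ->
  ghorizontal sigma L (psi i z.1) (tvec i (psi i z.1) z.2) (e - u) ->
  vpart sigma L (psi i z.1) (tvec i (psi i z.1) z.2) e = u.
Proof.
move=> dz vu hu; have [iq e1 jq Az] := adapted_chart dz.
apply: xget_unique => // u' [vu' hu']; rewrite -(tcoordK u' iq) -(tcoordK u iq).
apply: f_equal; apply/eqP; rewrite -subr_eq0; apply/eqP.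
have vD w : vertical sigma (psi i z.1) w -> tcoord i (psi i z.1) w *m D z.1 = 0.
  by move=> vw; apply/(vertical_adapted _ dz); rewrite tcoordK.
apply: (nondeg_adapted dz); first by rewrite mulmxBl !vD // subrr.
move=> w w0; have vw : vertical sigma (psi i z.1) (tvec i (psi i z.1) w).
  exact/(vertical_adapted _ dz).
have H a : ghorizontal sigma L (psi i z.1) (tvec i (psi i z.1) z.2) (e - a) ->
    (tcoord i (psi i z.1) e - tcoord i (psi i z.1) a) *m fundmx z *m w^T = 0.
  move=> /(_ _ vw); rewrite -[X in fund _ _ _ X](tcoordK _ iq) fund_adapted //.
  rewrite linearB => e0; apply/matrixP => a' b'.
  by rewrite (ord1 a') (ord1 b') e0 mxE.
have -> : tcoord i (psi i z.1) u' - tcoord i (psi i z.1) u =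
   (tcoord i (psi i z.1) e - tcoord i (psi i z.1) u) -
   (tcoord i (psi i z.1) e - tcoord i (psi i z.1) u').
  by rewrite opprB [RHS]addrC subrKA.
by rewrite mulmxBl mulmxBl !H // subrr.
Qed.

Lemma vpart_chart z e : adapted z ->
  vpart sigma L (psi i z.1) (tvec i (psi i z.1) z.2) (tvec i (psi i z.1) e) =
  tvec i (psi i z.1) (e *m vmx z).
Proof.
move=> dz; have uG := fundmx_unit (adapted_sub dz).
apply: (vpart_eq dz).
  apply/(vertical_adapted _ dz).
  by rewrite -mulmxA /vmx mulmxBl mul1mx hmx_slocmx // subrr mulmx0.
move=> w vw; have [iq e1 jq Az] := adapted_chart dz.
rewrite -linearB -(tcoordK w iq) fund_adapted //.
have -> : e - e *m vmx z = e *m hmx z.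
  by rewrite /vmx mulmxBr mulmx1 opprB addrC subrK.
have wD : tcoord i (psi i z.1) w *m D z.1 = 0.
  by apply/(vertical_adapted _ dz); rewrite tcoordK.
(* The final factors D^T G^-1 of [hmx] meet G w^T and leave (w D)^T, which is zero for vertical
   w. *)
by rewrite /hmx !mulmxA mulmxKV // -mulmxA -trmx_mul wD trmx0 mulmx0 mxE.
Qed.

Lemma hpart_chart z e : adapted z ->
  hpart sigma L (psi i z.1) (tvec i (psi i z.1) z.2) (tvec i (psi i z.1) e) =
  tvec i (psi i z.1) (e *m hmx z).
Proof.
move=> dz; rewrite /hpart vpart_chart // -linearB; apply: f_equal.
by rewrite /vmx mulmxBr mulmx1 opprB addrC subrK.
Qed.

End Projectors.
End Fundamental.

(** * O'Neill tensors in a chart *)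

Section ONeillChart.
Context {R : realType} {n m : nat} {M : manifold R n} {B : manifold R m}.
Variables (Adm : M -> set 'rV[R]_n) (L : M -> 'rV[R]_n -> R)
  (nabla : (M -> 'rV[R]_n) -> (M -> 'rV[R]_n) -> M -> 'rV[R]_n -> 'rV[R]_n)
  (sigma : M -> B).
Hypotheses (finslerM : pseudo_finsler Adm L) (conn : aconnection Adm nabla)
  (sm : smooth_map sigma)
  (surj : forall p (c : 'rV[R]_m), exists v, tmap sigma p v = c)
  (nondeg : vertical_nondegenerate sigma Adm L).
Variables (i : mindex M) (j : mindex B).
Implicit Types (q : M) (b c e h : 'rV[R]_n) (z : 'rV[R]_n * 'rV[R]_n).
Local Notation dom i := (cdom (mchart i)).
Local Notation phi i := (cmap (mchart i)).
Local Notation psi i := (cinv (mchart i)).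
Local Notation O := (@adapted R n M Adm i m B sigma j).
Local Notation G := (Gamma nabla i).
Local Notation Hm := (hmx L i sigma j).
Local Notation Vm := (vmx L i sigma j).

Let oO : open O. Proof. exact: (open_adapted finslerM). Qed.
Let OA : O `<=` tchart_img i Adm. Proof. exact: adapted_sub. Qed.
Let SH : smooth_mx O Hm. Proof. exact: smooth_hmx. Qed.
Let SV : smooth_mx O Vm. Proof. exact: smooth_vmx. Qed.
Let SG k l : smooth O (G k l).
Proof. by apply: smooth_sub OA _; exact: smooth_Gamma. Qed.
Let HDV z : O z -> Hm z + Vm z = 1%:M. Proof. by move=> _; exact: hmxDvmx. Qed.
Let HV z : O z -> Hm z *m Vm z = 0. Proof. exact: hmx_vmx. Qed.
Let VH z : O z -> Vm z *m Hm z = 0. Proof. exact: vmx_hmx. Qed.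

(* The common shape of hpart (with [Q := Hm]) and vpart (with [Q := Vm]). *)
Lemma cov_afield_part (P : M -> 'rV[R]_n -> 'rV[R]_n -> 'rV[R]_n)
    (Q : 'rV[R]_n * 'rV[R]_n -> 'M[R]_n) z h e :
  (forall z e, O z -> P (psi i z.1) (tvec i (psi i z.1) z.2)
     (tvec i (psi i z.1) e) = tvec i (psi i z.1) (e *m Q z)) ->
  smooth_mx O Q -> O z ->
  let q := psi i z.1 in
  tcoord i q (cov_afield nabla q (tvec i q z.2) h
    (fun a w => P a w (const_ext q e a))) =
  lcov G (fun y => rep i (const_ext q e) y.1 *m Q y) z (tcoord i q h).
Proof.
move=> PQ SQ Oz q.
have [iq e1 jq Az] := adapted_chart Oz.
pose U := dom i `&` dom (mat q).
have oU : open U by apply: openI; exact: cdom_open.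
pose G' := O `&` [set y | chart_img i U y.1].
have oG' : open G'.
  apply: openI; first exact: oO.
  apply: (@open_comp _ _ fst); first by move=> y _; exact: cvg_fst.
  exact: open_chart_img.
have zG' : G' z.
  by split=> //=; rewrite -e1; apply: chart_img_phi => //; split=> //; exact: mat_dom.
have SE : smooth_field U (const_ext q e).
  by apply: smooth_field_sub (smooth_const_ext q e) => a [].
have Sr : smooth G' (fun y => rep i (const_ext q e) y.1 *m Q y).
  apply: smooth_mulmx => //; last by apply: smooth_mx_sub SQ => y [].
  apply: (@smooth_comp _ _ _ _ _ (chart_img i U) fst (rep i (const_ext q e))) => //.
  - exact: finite_coords_rV.
  - by move=> y [].
  - exact: smooth_fst.
pose X a w := P a w (const_ext q e a).
have EX y : G' y -> rep i (const_ext q e) y.1 *m Q y = arep i X y.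
  move=> [Oy Cy]; have [ia _ _ _] := adapted_chart Oy.
  rewrite /arep /X -[const_ext q e (psi i y.1)](tcoordK _ ia) PQ //.
  by rewrite tvecK.
have SX : smooth G' (arep i X) by exact: (smooth_ext oG' EX Sr).
have zE : (phi i q, tcoord i q (tvec i q z.2)) = z.
  by rewrite e1 tvecK // -surjective_pairing.
have GA : G' `<=` tchart_img i Adm by move=> y [/OA].
have cX := @cov_afield_chart R n M Adm nabla conn i G' X q (tvec i q z.2) h oG' GA SX iq.
rewrite zE in cX; apply: (etrans (cX zG')).
apply: lcov_near_eq; last exact: (smooth_differentiable Sr zG').
by apply: filterS (open_nbhs_nbhs (conj oG' zG')) => y Gy; exact: EX.
Qed.

(** The extension [const_ext q e] is constant in the chart chosen at q, so its components in the
    chart i vary; [lchi_ext] removes their derivatives and only the value at q remains. The chart i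
    stays fixed while q moves, which is what allows chi to be differentiated afterwards. *)
Lemma oneill_chi_chart z h e : O z ->
  let q := psi i z.1 in
  oneill_chi sigma L nabla q (tvec i q z.2) h e =
  tvec i q (lchi G Hm Vm z (tcoord i q h) (tcoord i q e)).
Proof.
move=> Oz q; have [iq e1 jq Az] := adapted_chart Oz.
have vp y a : O y -> vpart sigma L (psi i y.1) (tvec i (psi i y.1) y.2)
    (tvec i (psi i y.1) a) = tvec i (psi i y.1) (a *m Vm y).
  by move=> Oy; exact: (vpart_chart finslerM sm surj nondeg).
have hp y a : O y -> hpart sigma L (psi i y.1) (tvec i (psi i y.1) y.2)
    (tvec i (psi i y.1) a) = tvec i (psi i y.1) (a *m Hm y).
  by move=> Oy; exact: (hpart_chart finslerM sm surj nondeg).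
pose v := tvec i q z.2; pose E := const_ext q e.
pose X1 := cov_afield nabla q v h (fun a w => hpart sigma L a w (E a)).
pose X2 := cov_afield nabla q v h (fun a w => vpart sigma L a w (E a)).
have E1 : tcoord i q X1 = lcov G (fun y => rep i E y.1 *m Hm y) z (tcoord i q h).
  exact: (cov_afield_part h e hp SH Oz).
have E2 : tcoord i q X2 = lcov G (fun y => rep i E y.1 *m Vm y) z (tcoord i q h).
  exact: (cov_afield_part h e vp SV Oz).
rewrite /oneill_chi -/v -/E -/X1 -/X2.
rewrite -(tcoordK X1 iq) -(tcoordK X2 iq) vp // hp // E1 E2 -linearD.
apply: (f_equal (tvec i q)).
have dE : differentiable (fun y : 'rV[R]_n * 'rV[R]_n =>
    rep i (const_ext q e) y.1) z.
  have S := smooth_const_ext q e i.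
  have d1 : differentiable (rep i (const_ext q e)) z.1.
    apply: (smooth_differentiable S).
    by rewrite -e1; apply: chart_img_phi => //; exact: mat_dom.
  have d2 : differentiable (fst : 'rV[R]_n * 'rV[R]_n -> _) z.
    by apply: (smooth_differentiable (@smooth_fst _ _ _ setT)).
  exact: (differentiable_comp d2 d1).
have L0 := lchi_ext G oO SH SV HV VH (tcoord i q h) Oz dE.
by rewrite /= {3}/rep const_ext_id in L0.
Qed.

Lemma oneill_A_chart z b e : O z ->
  let q := psi i z.1 in
  oneill_A sigma L nabla q (tvec i q z.2) b e =
  tvec i q (lchi G Hm Vm z (tcoord i q b *m Hm z) (tcoord i q e)).
Proof.
move=> Oz q; have [iq _ _ _] := adapted_chart Oz.
rewrite /oneill_A oneill_chi_chart // -{1}(tcoordK b iq) (hpart_chart finslerM sm surj nondeg _ Oz).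
by rewrite tvecK.
Qed.

Lemma oneill_T_chart z b e : O z ->
  let q := psi i z.1 in
  oneill_T sigma L nabla q (tvec i q z.2) b e =
  tvec i q (lchi G Hm Vm z (tcoord i q b *m Vm z) (tcoord i q e)).
Proof.
move=> Oz q; have [iq _ _ _] := adapted_chart Oz.
rewrite /oneill_T oneill_chi_chart // -{1}(tcoordK b iq) (vpart_chart finslerM sm surj nondeg _ Oz).
by rewrite tvecK.
Qed.

End ONeillChart.

(** * The covariant derivatives at a fixed admissible vector *)

Section AtPoint.
Context {R : realType} {n m : nat} {M : manifold R n} {B : manifold R m}.
Variables (Adm : M -> set 'rV[R]_n) (L : M -> 'rV[R]_n -> R)
  (nabla : (M -> 'rV[R]_n) -> (M -> 'rV[R]_n) -> M -> 'rV[R]_n -> 'rV[R]_n)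
  (sigma : M -> B).
Hypotheses (finslerM : pseudo_finsler Adm L) (conn : aconnection Adm nabla)
  (sm : smooth_map sigma)
  (surj : forall p (c : 'rV[R]_m), exists v, tmap sigma p v = c)
  (nondeg : vertical_nondegenerate sigma Adm L).
Variables (p : M) (v : 'rV[R]_n).
Hypothesis adm : Adm p v.
Implicit Types (b e h : 'rV[R]_n) (z : 'rV[R]_n * 'rV[R]_n).
Local Notation i := (mat p).
Local Notation j := (mat (sigma p)).
Local Notation psi := (cinv (mchart i)).
Local Notation O := (@adapted R n M Adm i m B sigma j).
Local Notation G := (Gamma nabla i).
Local Notation Hm := (hmx L i sigma j).
Local Notation Vm := (vmx L i sigma j).

(** With i the chart chosen at p, tangent vectors at p are their own components. *)
Definition point_coord : 'rV[R]_n * 'rV[R]_n := (cmap (mchart i) p, v).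
Local Notation z0 := point_coord.

Lemma psi_point : psi z0.1 = p.
Proof. by rewrite /= cmapK //; exact: mat_dom. Qed.

Lemma tcoord_id b : tcoord i p b = b.
Proof. by rewrite tcoordE tchange_id //; exact: mat_dom. Qed.

Lemma adapted_point : O z0.
Proof.
have ip := @mat_dom _ _ _ p; have jp := @mat_dom _ _ _ (sigma p).
split; last exact: chart_img_phi.
split; first exact: chart_img_phi.
by rewrite psi_point tvec_id.
Qed.

Lemma cov_const_ext h b : cov nabla p v h (const_ext p b) = christoffel G z0 h b.
Proof.
have ip := @mat_dom _ _ _ p; have oi := @cdom_open _ _ _ (mchart i).
rewrite -[LHS]tcoord_id /cov (nabla_chart conn oi) //; try exact: smooth_const_ext.
rewrite !const_ext_id !tcoord_id -[RHS]add0r; apply: (f_equal2 +%R) => //.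
have E : \forall x \near cmap (mchart i) p, (fun=> b) x = rep i (const_ext p b) x.
  apply: filterS (near_chart oi ip ip) => x /chart_imgP[ix _ _].
  by rewrite /rep /const_ext tvecK.
have d : differentiable (fun=> b) (cmap (mchart i) p) by exact: differentiable_cst.
have [_ _ e] := near_eq_diff E d.
apply: (etrans (congr1 (fun f => f h) e)).
exact: (congr1 (fun f => f h) (diff_cst b (cmap (mchart i) p))).
Qed.

(** One statement for both tensors: Q is the projection applied to the first argument of S, and b
    lies in its kernel. The formula for S is required at all adapted z, because S is
    differentiated. *)
Lemma cov_tensor12_part (Q Q' : 'rV[R]_n * 'rV[R]_n -> 'M[R]_n)
    (S : M -> 'rV[R]_n -> 'rV[R]_n -> 'rV[R]_n -> 'rV[R]_n) h b e :
  smooth_mx O Q -> smooth_mx O Q' ->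
  (forall z, O z -> Q z + Q' z = 1%:M) ->
  (forall z, O z -> Q z *m Q' z = 0) -> (forall z, O z -> Q' z *m Q z = 0) ->
  (forall z b e, O z -> S (psi z.1) (tvec i (psi z.1) z.2) b e =
     tvec i (psi z.1) (lchi G Q Q' z (tcoord i (psi z.1) b *m Q z)
                                     (tcoord i (psi z.1) e))) ->
  b *m Q z0 = 0 ->
  cov_tensor12 nabla S p v h b e = - S p v (lchi G Q Q' z0 h b) e.
Proof.
move=> SQ SQ' QD QQ' Q'Q SE bQ0; have Oz := adapted_point.
have ip := @mat_dom _ _ _ p.
have oO : open O by exact: (open_adapted finslerM).
have OA : O `<=` tchart_img i Adm by exact: adapted_sub.
have SG k l : smooth O (G k l) by apply: smooth_sub OA _; exact: smooth_Gamma.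
have Sp c d : S p v c d = lchi G Q Q' z0 (c *m Q z0) d.
  by have := SE z0 c d Oz; rewrite psi_point !tcoord_id !tvec_id.
pose X q w := S q w (const_ext p b q) (const_ext p e q).
have EX z : O z -> lchi G Q Q' z (b *m Q z) e = arep i X z.
  move=> Oy; have [iq _ _ _] := adapted_chart Oy.
  by rewrite /arep /X SE // /const_ext !tvecK.
have Sl : smooth O (fun z => lchi G Q Q' z (b *m Q z) e).
  apply: smooth_lchi => //.
  by apply: smooth_mulmx => //; exact: smooth_cst.
have SX : smooth O (arep i X) by exact: (smooth_ext oO EX Sl).
rewrite /cov_tensor12 !cov_const_ext !Sp.
have -> : cov_afield nabla p v h X = lcov G (fun z => lchi G Q Q' z (b *m Q z) e) z0 h.
  have Oz' : O (cmap (mchart i) p, tcoord i p v) by rewrite tcoord_id.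
  have E := cov_afield_chart conn h oO OA SX ip Oz'.
  rewrite !tcoord_id in E; apply: (etrans E).
  apply: lcov_near_eq; last exact: (smooth_differentiable Sl Oz).
  by apply: filterS (open_nbhs_nbhs (conj oO Oz)) => y Oy; exact: EX.
exact: (lcov_oneill oO SG SQ SQ' QD QQ' Q'Q).
Qed.

Lemma oneill_A_point b e :
  oneill_A sigma L nabla p v b e = lchi G Hm Vm z0 (b *m Hm z0) e.
Proof.
have := oneill_A_chart finslerM conn sm surj nondeg b e adapted_point.
by rewrite /= psi_point !tcoord_id !tvec_id.
Qed.

Lemma oneill_T_point b e :
  oneill_T sigma L nabla p v b e = lchi G Hm Vm z0 (b *m Vm z0) e.
Proof.
have := oneill_T_chart finslerM conn sm surj nondeg b e adapted_point.
by rewrite /= psi_point !tcoord_id !tvec_id.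
Qed.

Lemma oneill_TDA h b :
  oneill_T sigma L nabla p v h b + oneill_A sigma L nabla p v h b =
  lchi G Hm Vm z0 h b.
Proof.
rewrite oneill_A_point oneill_T_point -lchiD -mulmxDr addrC hmxDvmx.
by rewrite mulmx1.
Qed.

Lemma vpart_point b : vpart sigma L p v b = b *m Vm z0.
Proof.
have := vpart_chart finslerM sm surj nondeg b adapted_point.
by rewrite psi_point !tvec_id.
Qed.

(** A vertical vector is its own vertical part, so b = b V and b H = b V H = 0. *)
Lemma vertical_hmx b : vertical sigma p b -> b *m Hm z0 = 0.
Proof.
move=> vb; have bV : b *m Vm z0 = b.
  rewrite -vpart_point.
  have := @vpart_eq _ _ _ _ _ finslerM i m B sigma sm nondeg j z0 b b adapted_point.
  rewrite psi_point tvec_id; apply=> //.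
  move=> w vw; rewrite subrr.
  have := fund_adapted finslerM 0 w adapted_point.
  by rewrite psi_point !tvec_id mul0mx mul0mx mxE.
by rewrite -bV -mulmxA (vmx_hmx finslerM sm surj nondeg adapted_point) mulmx0.
Qed.

Lemma ghorizontal_vmx b : ghorizontal sigma L p v b -> b *m Vm z0 = 0.
Proof.
move=> hb; rewrite -vpart_point.
have := @vpart_eq _ _ _ _ _ finslerM i m B sigma sm nondeg j z0 b 0 adapted_point.
rewrite psi_point tvec_id subr0; apply=> //.
by rewrite /vertical /tmap linear0.
Qed.

Lemma cov_oneill_A h b e : vertical sigma p b ->
  cov_tensor12 nabla (oneill_A sigma L nabla) p v h b e =
  - oneill_A sigma L nabla p v
      (oneill_T sigma L nabla p v h b + oneill_A sigma L nabla p v h b) e.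
Proof.
move=> /vertical_hmx b0; rewrite oneill_TDA.
apply: cov_tensor12_part b0.
- exact: smooth_hmx.
- exact: smooth_vmx.
- by move=> z _; exact: hmxDvmx.
- by move=> z; exact: (hmx_vmx finslerM sm surj nondeg).
- by move=> z; exact: (vmx_hmx finslerM sm surj nondeg).
- by move=> z b' e' Oz; exact: (oneill_A_chart finslerM conn sm surj nondeg).
Qed.

(** The argument for A with the two projections exchanged; [lchi_sym] says that chi does not
    notice. *)
Lemma cov_oneill_T h b e : ghorizontal sigma L p v b ->
  cov_tensor12 nabla (oneill_T sigma L nabla) p v h b e =
  - oneill_T sigma L nabla p v
      (oneill_T sigma L nabla p v h b + oneill_A sigma L nabla p v h b) e.
Proof.
move=> /ghorizontal_vmx b0; rewrite oneill_TDA lchi_sym.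
apply: cov_tensor12_part b0.
- exact: smooth_vmx.
- exact: smooth_hmx.
- by move=> z _; rewrite addrC hmxDvmx.
- by move=> z; exact: (vmx_hmx finslerM sm surj nondeg).
- by move=> z; exact: (hmx_vmx finslerM sm surj nondeg).
- by move=> z b' e' Oz; rewrite lchi_sym; exact: (oneill_T_chart finslerM conn sm surj nondeg).
Qed.

Lemma oneill_A_vertical b e : vertical sigma p b ->
  oneill_A sigma L nabla p v b e = 0.
Proof. by move=> /vertical_hmx b0; rewrite oneill_A_point b0 lchi0. Qed.

Lemma oneill_T_horizontal b e : ghorizontal sigma L p v b ->
  oneill_T sigma L nabla p v b e = 0.
Proof. by move=> /ghorizontal_vmx b0; rewrite oneill_T_point b0 lchi0. Qed.

End AtPoint.
Unset Implicit Arguments.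

Theorem lemma7 (R : realType) (n m : nat)
    (M : manifold R n) (B : manifold R m)
    (Adm : M -> set 'rV[R]_n) (L : M -> 'rV[R]_n -> R)
    (AdmB : B -> set 'rV[R]_m) (LB : B -> 'rV[R]_m -> R)
    (sigma : M -> B)
    (nabla : (M -> 'rV[R]_n) -> (M -> 'rV[R]_n) -> M -> 'rV[R]_n -> 'rV[R]_n)
    (finslerM : pseudo_finsler Adm L)
    (finslerB : pseudo_finsler AdmB LB)
    (submersion : pf_submersion sigma Adm L AdmB LB)
    (nondegenerate : vertical_nondegenerate sigma Adm L)
    (chern : levi_civita_chern Adm L nabla)
    (p : M) (v : 'rV[R]_n) (admissible : Adm p v) :
  let A := oneill_A sigma L nabla in
  let T := oneill_T sigma L nabla in
  let DA := cov_tensor12 nabla A p v in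
  let DT := cov_tensor12 nabla T p v in
  (forall u w x y e : 'rV[R]_n,
     vertical sigma p u -> vertical sigma p w ->
     ghorizontal sigma L p v x -> ghorizontal sigma L p v y ->
     [/\ DA w u e = - A p v (T p v w u) e,
         DA x w e = - A p v (A p v x w) e,
         DT w y e = - T p v (T p v w y) e
       & DT x y e = - T p v (A p v x y) e]) /\
  (forall h w x e : 'rV[R]_n,
     vertical sigma p w -> ghorizontal sigma L p v x ->
     DA h w e = - A p v (T p v h w + A p v h w) e /\
     DT h x e = - T p v (T p v h x + A p v h x) e).
Proof.
move=> A T DA DT; have [conn _ _] := chern.
have [sm _ surj _ _] := submersion.
have DAE h w e : vertical sigma p w -> DA h w e = - A p v (T p v h w + A p v h w) e.
  by move=> vw; exact: (cov_oneill_A finslerM conn sm surj nondegenerate admissible).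
have DTE h x e : ghorizontal sigma L p v x ->
    DT h x e = - T p v (T p v h x + A p v h x) e.
  by move=> hx; exact: (cov_oneill_T finslerM conn sm surj nondegenerate admissible).
have Av b c : vertical sigma p b -> A p v b c = 0.
  by move=> vb; exact: (oneill_A_vertical finslerM conn sm surj nondegenerate admissible).
have Th b c : ghorizontal sigma L p v b -> T p v b c = 0.
  by move=> hb; exact: (oneill_T_horizontal finslerM conn sm surj nondegenerate admissible).
(* What remains is formal: the four separate equations are the succinct ones, in which A vanishes on
   a vertical first argument and T on a horizontal one. *)
clearbody DT DA T A.
split=> [u w x y e vu vw hx hy|h w x e vw hx]; last first.
  by split; [exact: DAE|exact: DTE].
split.
- by rewrite DAE // (Av w) // addr0.
- by rewrite DAE // (Th x) // add0r.
- by rewrite DTE // (Av w) // addr0.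
- by rewrite DTE // (Th x) // add0r.
Qed.
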